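(* Let $n \ge 2$ and let $\varepsilon>0$ be fixed and less than the Margulis constant of $\mathbb{H}^n$. Let $g,h \in \operatorname{Isom}^+(\mathbb{H}^n)$, where $g$ is parabolic with $g(\infty)=\infty$, and $h(\infty)\neq\infty$. If the group generated by $g$ and $h$ is discrete, then $$ R_h \leq \big( \mathscr{B}_g(v_h)\, \mathscr{B}_g(v_{h^{-1}}) \big)^{1/2}, $$ where $R_h$ is the radius of the isometric sphere of $h$, $v_h=h^{-1}(\infty)$ and $v_{h^{-1}}=h(\infty)$ are the centers (in $\mathbb{R}^{n-1}$) of the isometric spheres of $h$ and $h^{-1}$, and $\mathscr{B}_g:\mathbb{R}^{n-1}\to\mathbb{R}$ is the boundary function $$ \mathscr{B}_g(v)=\inf_{i\in\mathbb{N}} \frac{\|g^i(v)-v\|}{\sqrt{2\cosh(\varepsilon)-2}} , \qquad \mathbb{N}=\{1,2,3,\dots\}. $$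
   Context: $\mathbb{H}^n=\{(v,t): v\in\mathbb{R}^{n-1},\ t>0\}$ is the upper half-space model of $n$-dimensional real hyperbolic space, with metric $(dv^2+dt^2)/t^2$, distance $\rho$, and extended boundary $\partial\mathbb{H}^n=\mathbb{R}^{n-1}\cup\{\infty\}$. $\operatorname{Isom}^+(\mathbb{H}^n)$ is the group of orientation-preserving isometries of $\mathbb{H}^n$; each element extends continuously to a Möbius map of $\mathbb{R}^{n-1}\cup\{\infty\}$, denoted by the same letter. $\|\cdot\|$ is the Euclidean norm. A non-identity element of $\operatorname{Isom}^+(\mathbb{H}^n)$ is parabolic if its fixed point set in $\mathbb{H}^n\cup\partial\mathbb{H}^n$ consists of a single point, lying on $\partial\mathbb{H}^n$. A parabolic $g$ fixing $\infty$ has the form $g(v,t)=(Av+a,t)$ with $A\in\mathrm{SO}(n-1)$ and $a\in\mathbb{R}^{n-1}$ non-zero; on $\mathbb{R}^{n-1}$ it acts by $g(v)=Av+a$, and $g^i$ denotes the $i$-th iterate. Margulis constant: a number $\varepsilon>0$ is less than the Margulis constant of $\mathbb{H}^n$ if it is strictly smaller than the supremum of those $\mu>0$ such that for every discrete subgroup $\Gamma\subset\operatorname{Isom}^+(\mathbb{H}^n)$ and every $x\in\mathbb{H}^n$, the subgroup generated by $\{\gamma\in\Gamma:\rho(\gamma(x),x)<\mu\}$ is virtually nilpotent. Isometric sphere: let $h\in\operatorname{Isom}^+(\mathbb{H}^n)$ with $h(\infty)\neq\infty$, and put $v_h=h^{-1}(\infty)$, $v_{h^{-1}}=h(\infty)$,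 both in $\mathbb{R}^{n-1}$. For $v\in\mathbb{R}^{n-1}$ and $R>0$ let $S(v,R)=\{w\in\mathbb{R}^{n-1}:\|w-v\|=R\}$. The boundary map of $h$ sends each sphere $S(v_h,R)$ to a sphere $S(v_{h^{-1}},R')$, where $R\mapsto R'$ is decreasing with $R'\to\infty$ as $R\to0$ and $R'\to0$ as $R\to\infty$. $R_h>0$ is the unique radius such that $h(S(v_h,R_h))=S(v_{h^{-1}},R_h)$; one has $R_h=R_{h^{-1}}$. The isometric sphere of $h$ is the upper hemisphere in $\mathbb{H}^n$ with center $(v_h,0)$ and radius $R_h$. *)

(* Defs.v *)
From HB Require Import structures.
From mathcomp Require Import all_boot all_order all_algebra.
From mathcomp Require Import all_classical all_reals all_analysis.

Set Implicit Arguments.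
Unset Strict Implicit.
Unset Printing Implicit Defensive.

Import Order.TTheory GRing.Theory Num.Theory.
Import numFieldNormedType.Exports.

Local Open Scope classical_set_scope.
Local Open Scope ring_scope.

Section Groups.
Context {G : groupType}.
Implicit Types A N : set G.

Definition is_subgroup A :=
  [/\ A 1%g, forall x y, A x -> A y -> A (x * y)%g &
      forall x, A x -> A (x^-1)%g].

Definition generated A : set G := smallest is_subgroup A.

Fixpoint lower_central A (k : nat) : set G :=
  if k is k'.+1 then
    generated [set [~ x, y]%g | x in lower_central A k' & y in A]
  else A.

Definition nilpotent_subgroup A :=
  exists k, lower_central A k `<=` [set 1%g].

(* The left cosets xN, x in A, are finitely many. *)
Definition finite_index A N :=
  finite_set [set [set (x * y)%g | y in N] | x in A].

Definition virtually_nilpotent A :=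
  exists N, [/\ is_subgroup N, N `<=` A, finite_index A N &
                nilpotent_subgroup N].

End Groups.

Section HyperbolicSpace.
Variables (R : realType) (n : nat).

(* The canonical norm on row vectors is the sup norm. *)
Definition enorm m (v : 'rV[R]_m) : R := Num.sqrt (\sum_i v 0 i ^+ 2).

Definition cosh (x : R) : R := (expR x + expR (- x)) / 2.

(* As a type, [upper_half_space] carries the subspace topology. *)
Definition upper_half_space : set ('rV[R]_n.-1 * R) := [set x | 0 < x.2].
Local Notation HH := (set_type upper_half_space).

(* C^1 curves from x to y in the half-space. A C^1 curve on [0, 1] extends to a
   C^1 curve on R (affinely outside [0, 1]), so that it is harmless to ask for
   regularity on R; only the restriction to [0, 1] has to stay in the
   half-space. *)
Definition C1_path (x y : HH) : set (R -> 'rV[R]_n.-1 * R) :=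
  [set c : R -> 'rV[R]_n.-1 * R |
    [/\ forall s, derivable c s 1, continuous (derive1 c),
      c 0 = val x, c 1 = val y &
      forall s, 0 <= s <= 1 -> upper_half_space (c s)]].

(* Norm of c'(s) for the metric (dv^2 + dt^2) / t^2. *)
Definition hyp_speed (c : R -> 'rV[R]_n.-1 * R) (s : R) : R :=
  Num.sqrt (enorm (derive1 c s).1 ^+ 2 + (derive1 c s).2 ^+ 2) / (c s).2.

Definition hyp_length (c : R -> 'rV[R]_n.-1 * R) : \bar R :=
  (\int[lebesgue_measure]_(s in `[0%R, 1%R]) (hyp_speed c s)%:E)%E.

Definition rho (x y : HH) : R :=
  fine (ereal_inf [set hyp_length c | c in C1_path x y]).

(* Distance-preserving bijections; they are automatically smooth isometries of
   the Riemannian metric. The group law below is composition. *)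
Record isom := Isom {
  isom_fun :> HH -> HH;
  isom_inv : HH -> HH;
  isomK : cancel isom_fun isom_inv;
  isomVK : cancel isom_inv isom_fun;
  isom_rho : forall x y, rho (isom_fun x) (isom_fun y) = rho x y }.

Lemma isom_eq (g h : isom) : isom_fun g =1 isom_fun h -> g = h.
Proof.
case: g h => [f f' fK f'K fr] [k k' kK k'K kr] /= /funext fk.
case: _ / fk in kK k'K kr *.
have fk' : f' = k' by apply/funext => x; rewrite -{1}(k'K x) fK.
case: _ / fk' in kK k'K *.
by congr Isom; exact: Prop_irrelevance.
Qed.

HB.instance Definition _ := gen_eqMixin isom.
HB.instance Definition _ := gen_choiceMixin isom.

Definition isom_one : isom := @Isom id id (fun=> erefl) (fun=> erefl)
  (fun _ _ => erefl).

Definition isom_mul (g h : isom) : isom.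
Proof.
refine (@Isom (g \o h) (isom_inv h \o isom_inv g) _ _ _).
- exact: can_comp (@isomK g) (@isomK h).
- exact: can_comp (@isomVK h) (@isomVK g).
- by move=> x y /=; rewrite !isom_rho.
Defined.

Definition isom_invg (g : isom) : isom.
Proof.
refine (@Isom (isom_inv g) g (@isomVK g) (@isomK g) _).
by move=> x y; rewrite -(isom_rho g) !isomVK.
Defined.

Fact isom_mulA : associative isom_mul.
Proof. by move=> f g h; exact: isom_eq. Qed.

Fact isom_mul1 : left_id isom_one isom_mul.
Proof. by move=> f; exact: isom_eq. Qed.

Fact isom_1mul : right_id isom_one isom_mul.
Proof. by move=> f; exact: isom_eq. Qed.

Fact isom_mulV : left_inverse isom_one isom_invg isom_mul.
Proof. by move=> f; apply: isom_eq => x /=; rewrite isomK. Qed.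

Fact isom_Vmul : right_inverse isom_one isom_invg isom_mul.
Proof. by move=> f; apply: isom_eq => x /=; rewrite isomVK. Qed.

HB.instance Definition _ :=
  isGroup.Build isom isom_mulA isom_mul1 isom_1mul isom_mulV isom_Vmul.

(* Coordinates in R^n, where the library's Jacobian matrices are available. *)
Definition flat (x : 'rV[R]_n.-1 * R) : 'rV[R]_(n.-1 + 1) :=
  row_mx x.1 x.2%:M.

Definition unflat (y : 'rV[R]_(n.-1 + 1)) : 'rV[R]_n.-1 * R :=
  (lsubmx y, rsubmx y 0 0).

(* The map g read in R^n; its (irrelevant) value is 0 outside the open
   half-space. *)
Definition flat_isom (g : isom) (y : 'rV[R]_(n.-1 + 1)) : 'rV[R]_(n.-1 + 1) :=
  oapp (fun x : HH => flat (val (g x))) 0 (insub (unflat y)).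

Definition orientation_preserving (g : isom) :=
  forall x : HH, differentiable (flat_isom g) (flat (val x)) /\
    0 < \det ('J (flat_isom g) (flat (val x))).

Definition Isom_plus : set isom := [set g | orientation_preserving g].

(* Every element is isolated for the compact-open topology, the usual topology
   of the isometry group. *)
Definition discrete (Gamma : set isom) :=
  forall g, Gamma g ->
    isolated ([set (h : HH -> HH) | h in Gamma] :
                set {compact-open, HH -> HH}) (g : HH -> HH).

Definition boundary : Type := one_point_compactification 'rV[R]_n.-1.

Definition infty : boundary := None.

(* The union of the half-space and its boundary embeds as the closed half-space
   plus a point at infinity in the one-point compactification of
   R^(n-1) x R. *)
Definition closure_space : topologicalType :=
  one_point_compactification ('rV[R]_n.-1 * R)%type.

Definition of_interior (x : HH) : closure_space := Some (val x).

Definition of_boundary (xi : boundary) : closure_space :=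
  omap (fun v => (v, 0)) xi.

Definition approach (xi : boundary) : set_system HH :=
  filter_from (nbhs (of_boundary xi)) (fun U => of_interior @^-1` U).

(* The continuous extension of g to the boundary: g(xi) is the limit of g(x) as
   x tends to xi inside the half-space. *)
Definition bdry (g : isom) (xi : boundary) : boundary :=
  xget infty [set eta : boundary |
    of_interior (g x) @[x --> approach xi] --> of_boundary eta].

Definition parabolic (g : isom) :=
  [/\ g <> 1%g, forall x : HH, g x <> x &
      exists xi, [set zeta | bdry g zeta = zeta] = [set xi]].

Definition margulis_constant : \bar R :=
  ereal_sup [set mu%:E | mu in [set mu : R | 0 < mu /\
    forall Gamma : set isom, is_subgroup Gamma -> Gamma `<=` Isom_plus ->
      discrete Gamma ->
      forall x : HH, virtually_nilpotent
        (generated [set g | Gamma g /\ rho (g x) x < mu])]].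

(* v_h = h^-1(infty), a point of R^(n-1) as soon as h(infty) <> infty; the
   default value 0 is then not used. *)
Definition isom_center (h : isom) : 'rV[R]_n.-1 :=
  odflt 0 (bdry h^-1%g infty).

Definition esphere (v : 'rV[R]_n.-1) (r : R) : set boundary :=
  [set Some w | w in [set w | enorm (w - v) = r]].

(* R_h; the default value 0 is not used when h(infty) <> infty. *)
Definition isom_radius (h : isom) : R :=
  xget 0 [set r : R | 0 < r /\
    bdry h @` esphere (isom_center h) r = esphere (isom_center h^-1%g) r].

Definition boundary_function (eps : R) (g : isom) (v : 'rV[R]_n.-1) : R :=
  inf [set r : R | exists i w, [/\ (0 < i)%N,
    iter i (bdry g) (Some v) = Some w &
    r = enorm (w - v) / Num.sqrt (2 * cosh eps - 2)]].

End HyperbolicSpace.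

Arguments infty {R n}.

(* Main.v *)
Require Import Defs.
From HB Require Import structures.
From mathcomp Require Import all_boot all_order all_algebra.
From mathcomp Require Import ring lra.
From mathcomp Require Import all_classical all_reals all_analysis.

Set Implicit Arguments.
Unset Strict Implicit.
Unset Printing Implicit Defensive.

Import Order.TTheory GRing.Theory Num.Theory.
Import numFieldNormedType.Exports.

Local Open Scope classical_set_scope.
Local Open Scope ring_scope.

(** Write a = v_h and b = v_(h^-1), and let r be the radius of the isometric
    sphere. The map h sends the vertical line over a to the vertical line over
    b and inverts heights: h(a, s) = (b, r^2 / s). The power g^i is a Euclidean
    isometry on every horizontal slice, so the distance rho by which it moves
    (v, s) satisfies 2 cosh rho = 2 + |g^i(v) - v|^2 / s^2, and this distance is
    less than eps as soon as s exceeds |g^i(v) - v| / sqrt(2 cosh eps - 2). If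
    r^2 were larger than B(a) B(b), where B is the boundary function of g, one
    could choose u1 > B(a) and u2 > B(b) with u1 u2 < r^2, and powers g^i and g^j
    that realise these bounds. Then x = (a, u1) is moved by less than eps by g^i,
    and h(x), of height r^2 / u1 > u2, is moved by less than eps by g^j; so x is
    moved by less than eps both by p = g^i and by q = h^-1 g^j h. Discreteness
    and the choice of eps put p and q in a virtually nilpotent group, and
    suitable powers of them in a nilpotent group N. All positive powers of p
    fix only infinity, those of q only a. This is impossible: a nilpotent group
    that contains an element with a single fixed point fixes that point
    ([lower_central_fixed]), so the two points would agree.

    The rest of the file makes this elementary picture available from the
    definitions: the distance is an infimum of lengths, isometries are
    bijections preserving it, and the boundary map is a limit.

    Distance. [pairing x y] = (|v - w|^2 + t^2 + s^2) / (t s) equals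
    2 cosh (rho x y) ([pairing_rho]). The upper bound is given by explicit
    unit-speed geodesics; the lower bound holds because the Busemann function
    ln (horo xi) is 1-Lipschitz for the hyperbolic metric and is affine of slope
    1 or -1 along a geodesic that ends at xi.

    Boundary. As x tends to an ideal point xi, a suitable multiple of
    [pairing x y] tends to [horofun xi y], the exponential of a Busemann
    function. As an isometry f preserves the pairing, and as the coordinates of
    f(x) can be read off its pairings with finitely many points, f(x) has a
    limit eta, and horofun xi = c * (horofun eta o f) for some c > 0. This relation
    determines eta ([horofun_inj]), so every statement about the boundary map
    becomes algebra: the maps compose, an isometry fixing infinity is a
    Euclidean similarity (v, t) |-> (phi v, c t), and h(a, s) = (b, r^2 / s).
    For a parabolic element c = 1, since otherwise phi would have a fixed point
    by the contraction principle; no positive power of phi has a fixed point v,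
    since the centroid of the finite orbit of v would be fixed by phi.

    Orientation. The hypothesis on eps speaks of groups of orientation-preserving
    isometries. The same pairings show that each isometry is a rational map,
    hence differentiable, and the chain rule makes [Isom_plus] a group. *)

(** * Euclidean vectors *)

Section EuclideanVectors.
Context {R : realType} {m : nat}.
Implicit Types u v w : 'rV[R]_m.

Definition dot u v : R := \sum_i u 0 i * v 0 i.

Definition nsq u : R := dot u u.

Lemma dotC u v : dot u v = dot v u.
Proof. by apply: eq_bigr => i _; rewrite mulrC. Qed.

Lemma dotDl u v w : dot (u + v) w = dot u w + dot v w.
Proof. by rewrite -big_split; apply: eq_bigr => i _; rewrite mxE mulrDl. Qed.

Lemma dotZl k u v : dot (k *: u) v = k * dot u v.
Proof. by rewrite mulr_sumr; apply: eq_bigr => i _; rewrite mxE mulrA. Qed.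

Lemma dot0l v : dot 0 v = 0.
Proof. by rewrite -(scale0r 0) dotZl mul0r. Qed.

Lemma dot_suml (I : finType) (F : I -> 'rV[R]_m) v :
  dot (\sum_i F i) v = \sum_i dot (F i) v.
Proof. by apply: (big_morph (dot^~ v)) => [u w|]; [exact: dotDl|exact: dot0l]. Qed.

Lemma dotDr u v w : dot w (u + v) = dot w u + dot w v.
Proof. by rewrite !(dotC w) dotDl. Qed.

Lemma dotZr k u v : dot v (k *: u) = k * dot v u.
Proof. by rewrite !(dotC v) dotZl. Qed.

Lemma dotNl u v : dot (- u) v = - dot u v.
Proof. by rewrite -scaleN1r dotZl mulN1r. Qed.

Lemma dotNr u v : dot v (- u) = - dot v u.
Proof. by rewrite !(dotC v) dotNl. Qed.

Lemma dot_delta u i : dot u (delta_mx 0 i) = u 0 i.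
Proof.
rewrite /dot (bigD1 i)//= big1 ?mxE ?eqxx ?mulr1 ?addr0// => j /negbTE ji.
by rewrite mxE ji mulr0.
Qed.

Definition dotE := (dotDl, dotDr, dotZl, dotZr, dotNl, dotNr).

Lemma enormE u : enorm u = Num.sqrt (nsq u).
Proof. by congr Num.sqrt; apply: eq_bigr => i _; rewrite expr2. Qed.

Lemma nsq_ge0 u : 0 <= nsq u.
Proof. by apply: sumr_ge0 => i _; rewrite -expr2 sqr_ge0. Qed.

Lemma nsq_coord u i : u 0 i ^+ 2 <= nsq u.
Proof.
rewrite /nsq/dot (bigD1 i)//= expr2 lerDl; apply: sumr_ge0 => j _.
by rewrite -expr2 sqr_ge0.
Qed.

Lemma nsq0 : nsq 0 = 0.
Proof. by rewrite /nsq/dot big1// => i _; rewrite mxE mul0r. Qed.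

Lemma nsq_eq0 u : (nsq u == 0) = (u == 0).
Proof.
apply/eqP/eqP => [u0|->]; last exact: nsq0.
apply/rowP => i; rewrite mxE; apply/eqP.
by rewrite -sqrf_eq0 eq_le sqr_ge0 -u0 nsq_coord.
Qed.

Lemma nsqN u : nsq (- u) = nsq u.
Proof. by rewrite /nsq !dotE opprK. Qed.

Lemma nsqBC u v : nsq (u - v) = nsq (v - u).
Proof. by rewrite -nsqN opprB. Qed.

Lemma nsqZ k u : nsq (k *: u) = k ^+ 2 * nsq u.
Proof. by rewrite /nsq !dotE; ring. Qed.

Lemma enorm_ge0 u : 0 <= enorm u.
Proof. exact: sqrtr_ge0. Qed.

Lemma enorm_sqr u : enorm u ^+ 2 = nsq u.
Proof. by rewrite enormE sqr_sqrtr ?nsq_ge0. Qed.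

Lemma nsq_delta i : nsq (delta_mx 0 i) = 1.
Proof. by rewrite /nsq dot_delta mxE !eqxx. Qed.

Lemma nsqD u v : nsq (u + v) = nsq u + 2 * dot v u + nsq v.
Proof. by rewrite /nsq !dotE (dotC u v); ring. Qed.

(** Cauchy-Schwarz in R^m x R, with the norms of the two vectors given by their
    squares: in the application the first norm is known in closed form. *)
Lemma cauchy_schwarz u w (a b q N : R) : 0 < q -> 0 <= N ->
  nsq u + a ^+ 2 = q ^+ 2 -> nsq w + b ^+ 2 = N ^+ 2 ->
  dot u w + a * b <= q * N.
Proof.
move=> q0 N0 hu hw.
have [N00|Npos] := eqVneq N 0.
  rewrite N00 expr0n/= in hw.
  have /eqP b0 : b == 0 by rewrite -sqrf_eq0; have := nsq_ge0 w; have := sqr_ge0 b; lra.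
  have /eqP : nsq w = 0 by move: hw; rewrite b0 expr0n/= addr0.
  rewrite nsq_eq0 => /eqP->; rewrite b0 N00 -[0](scale0r 0) dotZr; lra.
have Np : 0 < N by rewrite lt_neqAle eq_sym Npos.
have := nsq_ge0 (N *: u - q *: w); have := sqr_ge0 (N * a - q * b).
rewrite /nsq !dotE -/(nsq u) -/(nsq w) (dotC w u) => h1 h2.
rewrite -(ler_pM2l (mulr_gt0 q0 Np)).
have : 0 <= N ^+ 2 * (nsq u + a ^+ 2) + q ^+ 2 * (nsq w + b ^+ 2)
   - 2 * (q * N * (dot u w + a * b)) by move: h1 h2; nra.
rewrite hu hw; nra.
Qed.

End EuclideanVectors.

(** * Horofunctions and a lower bound for lengths *)

Lemma derive1_linear (R : realType) (V W : normedModType R)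
    (L : {linear V -> W}) (c : R -> V) (s : R) :
  continuous L -> derivable c s 1 -> is_derive s 1 (L \o c) (L (c^`()%classic s)).
Proof.
move=> Lc /derivable1_diffP dc.
have dL : differentiable L (c s) by exact: linear_differentiable.
have dLc := differentiable_comp dc dL.
apply: DeriveDef; first exact: diff_derivable.
by rewrite -derive1E derive1E'// diff_comp//= diff_lin// derive1E'.
Qed.

Section Curves.
Context {R : realType} {n : nat}.
Local Notation V := ('rV[R]_n.-1).
Local Notation HH := (set_type (@upper_half_space R n)).
Implicit Types (x y : HH) (xi : V) (c : R -> V * R).

Lemma height_gt0 x : 0 < (val x).2.
Proof. exact: (set_mem (valP x)). Qed.

Definition hpoint (v : V) (t : R) (t0 : 0 < t) : HH := exist _ (v, t) (mem_set t0).

(** The exponential of the Busemann function of the ideal point xi. *)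
Definition horo xi (p : V * R) : R := (nsq (p.1 - xi) + p.2 ^+ 2) / p.2.

Lemma horo_gt0 xi (p : V * R) : 0 < p.2 -> 0 < horo xi p.
Proof.
by move=> p0; rewrite divr_gt0// ltr_wpDl ?nsq_ge0// exprn_gt0.
Qed.

Section OneCurve.
Context {c : R -> V * R}.
Hypothesis dc : forall s, derivable c s 1.

Lemma continuous_curve : continuous c.
Proof. by move=> s; apply/differentiable_continuous/derivable1_diffP. Qed.

Lemma is_derive_fst_curve (s : R) i :
  is_derive s 1 (fun s : R => (c s).1 0 i) ((c^`()%classic s).1 0 i).
Proof.
have h : is_derive s 1 (fst \o c) (c^`()%classic s).1.
  by apply: derive1_linear => // p; exact: cvg_fst.
have h1 : derivable (fst \o c) s 1 by exact: ex_derive.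
have h2 := (derivable_mxP _ _ _).1 h1 0 i.
apply: DeriveDef => //.
have := @derive_val _ _ _ _ _ _ _ h.
by rewrite derive_mx// => /matrixP/(_ 0 i); rewrite mxE.
Qed.

Lemma is_derive_snd_curve (s : R) :
  is_derive s 1 (fun s : R => (c s).2) ((c^`()%classic s).2).
Proof. by apply: derive1_linear => // p; exact: cvg_snd. Qed.

End OneCurve.

Lemma continuous_nsq (T : topologicalType) (f : T -> V) (a : T) :
  {for a, continuous f} -> {for a, continuous (fun s => nsq (f s))}.
Proof.
move=> cf; apply: cvg_big => [|i _]; first exact: add_continuous.
by apply: cvgM; apply: (@cvg_comp _ _ _ f (fun M : V => M 0 i) _ _ _ cf);
  exact: coord_continuous.
Qed.

Lemma continuous_dot (T : topologicalType) (f g : T -> V) (a : T) :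
  {for a, continuous f} -> {for a, continuous g} ->
  {for a, continuous (fun s => dot (f s) (g s))}.
Proof.
move=> cf cg; apply: cvg_big => [|i _]; first exact: add_continuous.
apply: cvgM; first by apply: (@cvg_comp _ _ _ f (fun M : V => M 0 i) _ _ _ cf);
  exact: coord_continuous.
by apply: (@cvg_comp _ _ _ g (fun M : V => M 0 i) _ _ _ cg);
  exact: coord_continuous.
Qed.

(** The derivative of ln (horo xi) along c. *)
Definition horo_slope xi c (s : R) : R :=
  (2 * (c s).2 * dot ((c s).1 - xi) (c^`()%classic s).1
   + ((c s).2 ^+ 2 - nsq ((c s).1 - xi)) * (c^`()%classic s).2)
  / ((nsq ((c s).1 - xi) + (c s).2 ^+ 2) * (c s).2).

Lemma is_derive_ln_horo xi c s : (forall s, derivable c s 1) -> 0 < (c s).2 ->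
  is_derive s 1 (fun s : R => ln (horo xi (c s))) (horo_slope xi c s).
Proof.
move=> dc c0.
have d1 i := is_derive_fst_curve dc s i; have d2 := is_derive_snd_curve dc s.
have dn : is_derive s 1 (fun s => nsq ((c s).1 - xi))
    (2 * dot ((c s).1 - xi) (c^`()%classic s).1).
  have -> : (fun s => nsq ((c s).1 - xi)) =
    \sum_i (fun s => ((c s).1 0 i - xi 0 i) ^+ 2).
    by apply/funext => r; rewrite fct_sumE; apply: eq_bigr => i _; rewrite !mxE expr2.
  have -> : 2 * dot ((c s).1 - xi) (c^`()%classic s).1 =
    \sum_i (2 * (((c s).1 0 i - xi 0 i) * (c^`()%classic s).1 0 i)).
    by rewrite -mulr_sumr; congr (_ * _); apply: eq_bigr => i _; rewrite !mxE.
  apply: is_derive_sum => i; apply: is_derive_eq.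
  rewrite /GRing.scale/=. ring.
have c0' : (c s).2 != 0 by rewrite gt_eqF.
have dv := is_deriveV c0' d2.
have dh : is_derive s 1 (fun s => horo xi (c s))
   (horo_slope xi c s * horo xi (c s)).
  apply: is_derive_eq.
  have q0 : nsq ((c s).1 - xi) + (c s).2 ^+ 2 != 0.
    by rewrite gt_eqF// ltr_wpDl ?nsq_ge0// exprn_gt0.
  rewrite /GRing.scale/= /horo /horo_slope.
  move: (nsq _) q0 (dot _ _) => A q0 B; field.
  by rewrite q0 c0'.
have h0 := horo_gt0 xi c0.
apply: is_derive_eq; first exact: (@is_derive1_comp _ (@ln R) (fun s => horo xi (c s)) s _ _
    (is_derive1_ln h0) dh).
by rewrite mulrC mulfK// gt_eqF.
Qed.

(** The gradient of ln (horo xi) has hyperbolic norm 1: with u = v - xi its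
    components are 2 t u and t^2 - |u|^2 over (|u|^2 + t^2) t, and
    4 t^2 |u|^2 + (t^2 - |u|^2)^2 = (|u|^2 + t^2)^2. *)
Lemma horo_slope_le xi c s : 0 < (c s).2 -> `|horo_slope xi c s| <= hyp_speed c s.
Proof.
move=> c0; rewrite /horo_slope /hyp_speed enorm_sqr.
set u := _ - xi; set t := (c s).2 in c0 *; set w := (_ s).1; set b := (_ s).2.
set N := Num.sqrt _.
have N0 : 0 <= N by exact: sqrtr_ge0.
have hN : nsq w + b ^+ 2 = N ^+ 2.
  by rewrite sqr_sqrtr// addr_ge0 ?nsq_ge0 ?sqr_ge0.
set q := nsq u + t ^+ 2.
have q0 : 0 < q by rewrite ltr_wpDl ?nsq_ge0// exprn_gt0.
have hq : nsq (2 * t *: u) + (t ^+ 2 - nsq u) ^+ 2 = q ^+ 2 by rewrite nsqZ /q; ring.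
have hq' : nsq (- (2 * t *: u)) + (nsq u - t ^+ 2) ^+ 2 = q ^+ 2
   by rewrite nsqN nsqZ /q; ring.
have := cauchy_schwarz q0 N0 hq hN; have := cauchy_schwarz q0 N0 hq' hN.
rewrite !dotE => h1 h2.
rewrite invfM mulrA normrM (gtr0_norm (x := t^-1)) ?invr_gt0//.
rewrite ler_pM2r ?invr_gt0// normrM (gtr0_norm (x := q^-1)) ?invr_gt0//.
rewrite ler_pdivrMr// mulrC ler_norml; apply/andP; split; lra.
Qed.

Lemma continuous_horo_slope xi c s : (forall s, derivable c s 1) ->
  continuous (c^`()%classic) -> 0 < (c s).2 ->
  {for s, continuous (horo_slope xi c)}.
Proof.
move=> dc cc' c0.
have cc := continuous_curve dc.
have c1 : {for s, continuous (fun s => (c s).1 - xi)}.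
  by apply: cvgB; [apply: (cvg_comp _ _ (cc s)); exact: cvg_fst|exact: cvg_cst].
have c2 : {for s, continuous (fun s => (c s).2)}.
  by apply: (cvg_comp _ _ (cc s)); exact: cvg_snd.
have c1' : {for s, continuous (fun s => (c^`()%classic s).1)}.
  by apply: (cvg_comp _ _ (cc' s)); exact: cvg_fst.
have c2' : {for s, continuous (fun s => (c^`()%classic s).2)}.
  by apply: (cvg_comp _ _ (cc' s)); exact: cvg_snd.
have cn := continuous_nsq c1; have cd := continuous_dot c1 c1'.
have cX : {for s, continuous (fun s => (c s).2 ^+ 2)}.
  by apply: (@cvg_comp _ _ _ (fun s => (c s).2) (fun t => t ^+ 2) _ _ _ c2);
    exact: exprn_continuous.
have c3 : {for s, continuous (fun s => 2 * (c s).2)}.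
  by apply: cvgM => //; exact: cvg_cst.
have c4 : {for s, continuous (fun s => (c s).2 ^+ 2 - nsq ((c s).1 - xi))}.
  exact: cvgB.
have c5 : {for s, continuous (fun s => (nsq ((c s).1 - xi) + (c s).2 ^+ 2) * (c s).2)}.
  by apply: cvgM => //; exact: cvgD.
apply: cvgM; first by apply: cvgD; [exact: (cvgM c3 cd)|exact: (cvgM c4 c2')].
apply: cvgV => //.
by rewrite mulf_neq0// gt_eqF// ltr_wpDl ?nsq_ge0// exprn_gt0.
Qed.

Lemma continuous_hyp_speed c s : (forall s, derivable c s 1) ->
  continuous (c^`()%classic) -> 0 < (c s).2 ->
  {for s, continuous (hyp_speed c)}.
Proof.
move=> dc cc' c0; have cc := continuous_curve dc.
have c2 : {for s, continuous (fun s => (c s).2)}.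
  by apply: (cvg_comp _ _ (cc s)); exact: cvg_snd.
have c1' : {for s, continuous (fun s => (c^`()%classic s).1)}.
  by apply: (cvg_comp _ _ (cc' s)); exact: cvg_fst.
have c2' : {for s, continuous (fun s => (c^`()%classic s).2)}.
  by apply: (cvg_comp _ _ (cc' s)); exact: cvg_snd.
apply: cvgM; last by apply: cvgV => //; rewrite gt_eqF.
rewrite (_ : (fun _ => _) = fun s => Num.sqrt (nsq (c^`()%classic s).1 + (c^`()%classic s).2 ^+ 2)).
  have cX : {for s, continuous (fun s => (c^`()%classic s).2 ^+ 2)}.
    by apply: (@cvg_comp _ _ _ (fun s => (c^`()%classic s).2) (fun t => t ^+ 2) _ _ _ c2');
      exact: exprn_continuous.
  have h : {for s, continuous (fun s => nsq (c^`()%classic s).1 + (c^`()%classic s).2 ^+ 2)}.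
    by apply: cvgD => //; exact: (continuous_nsq c1').
  rewrite enorm_sqr.
  by apply: (@cvg_comp _ _ _ _ Num.sqrt _ _ _ h); exact: sqrt_continuous.
by apply/funext => r; rewrite enorm_sqr.
Qed.

Lemma ln_horo_le_length xi x y c : C1_path x y c ->
  (`|ln (horo xi (val y)) - ln (horo xi (val x))|%:E <= hyp_length c)%E.
Proof.
move=> [dc cc' c0 c1 cH].
have cpos s : s \in `[0, 1]%R -> 0 < (c s).2.
  by rewrite in_itv/= => /cH.
have cslope : {within `[0, 1], continuous (horo_slope xi c)}.
  apply: continuous_in_subspaceT => s /set_mem/= s01.
  by apply: continuous_horo_slope => //; exact: cpos.
have cspeed : {within `[0, 1], continuous (hyp_speed c)}.
  apply: continuous_in_subspaceT => s /set_mem/= s01.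
  by apply: continuous_hyp_speed => //; exact: cpos.
have dF (s : R) : s \in `[0, 1]%R ->
    is_derive s 1 (fun s : R => ln (horo xi (c s))) (horo_slope xi c s).
  by move=> s01; apply: is_derive_ln_horo => //; exact: cpos.
have cF (s : R) : s \in `[0, 1]%R ->
    {for s, continuous (fun s : R => ln (horo xi (c s)))}.
  move=> /dF h; apply/differentiable_continuous/derivable1_diffP.
  by apply: ex_derive; exact: h.
have sub (s : R) : s \in `]0, 1[%R -> s \in `[0, 1]%R by exact: subset_itv_oo_cc.
have := @continuous_FTC2 R (horo_slope xi c) (fun s => ln (horo xi (c s))) 0 1 ltr01 cslope.
rewrite c0 c1 -EFinB => FTC.
rewrite -abse_EFin -FTC; last 2 first.
- split.
  + by move=> s /sub s01; apply: ex_derive; exact: dF.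
  + apply: cvg_at_right_filter; apply: cF.
    by rewrite in_itv/= lexx ler01.
  + apply: cvg_at_left_filter; apply: cF.
    by rewrite in_itv/= lexx ler01.
- by move=> s /sub s01; rewrite derive1E; apply: derive_val; exact: dF.
have i1 := continuous_compact_integrable (@segment_compact R 0 1) cslope.
have i2 := continuous_compact_integrable (@segment_compact R 0 1) cspeed.
apply: le_trans (le_abse_integral _ _ _) _ => //.
  by case/integrableP : i1.
apply: ge0_le_integral => //.
- by have /integrableP[] := integrable_abse i1.
- by case/integrableP : i2.
- move=> s s01; rewrite /= lee_fin.
  by apply: horo_slope_le; exact: cpos.
Qed.

End Curves.

(** * Geodesics and the distance formula *)

Section Geodesics.
Context {R : realType} {n : nat}.
Local Notation V := ('rV[R]_n.-1).
Local Notation HH := (set_type (@upper_half_space R n)).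
Implicit Types (x y : HH) (xi : V) (c : R -> V * R).

Lemma is_derive_scalel (W : normedModType R) (w : W) (k : R -> R) (s k' : R) :
  is_derive s 1 k k' -> is_derive s 1 (fun s => k s *: w) (k' *: w).
Proof.
move=> dk.
have dk1 : differentiable k s by apply/derivable1_diffP; exact: ex_derive.
have dw : differentiable (fun s => k s *: w) s by exact: differentiableZl.
apply: DeriveDef; first exact: diff_derivable.
rewrite deriveE// diffZl// -(@deriveE _ _ _ k)//; congr (_ *: _).
exact: derive_val.
Qed.

Fact scale_pair (k : R) (u : V) (t : R) : k *: (u, t) = (k *: u, k * t) :> V * R.
Proof. by []. Qed.

Fact add_pair (u v : V) (s t : R) : (u, s) + (v, t) = (u + v, s + t) :> V * R.
Proof. by []. Qed.

(** Vertical lines and half-circles both lie in a plane spanned by a horizontal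
    direction u and the vertical one. *)
Definition planar (m u : V) (k t : R -> R) (s : R) : V * R := (m + k s *: u, t s).

Lemma planarE m u k t :
  planar m u k t = fun s => (m, 0) + k s *: (u, 0 : R) + t s *: (0, 1 : R).
Proof.
apply/funext => s; rewrite /planar !scale_pair !add_pair.
by rewrite scaler0 !mulr0 mulr1 !addr0 add0r.
Qed.

Lemma is_derive_planar m u (k t : R -> R) (s k' t' : R) :
  is_derive s 1 k k' -> is_derive s 1 t t' ->
  is_derive s 1 (planar m u k t) (k' *: u, t').
Proof.
move=> dk dt; rewrite planarE.
have d1 := is_derive_scalel (u, 0 : R) dk.
have d2 := is_derive_scalel (0 : V, 1 : R) dt.
apply: is_derive_eq.
by rewrite !scale_pair add0r add_pair scaler0 mulr0 mulr1 addr0 add0r.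
Qed.

Lemma continuous_planar m u (k t : R -> R) :
  continuous k -> continuous t -> continuous (planar m u k t).
Proof.
move=> ck ct s; rewrite planarE; apply: cvgD; last by apply: cvgZr_tmp; exact: ct.
by apply: cvgD; [exact: cvg_cst|apply: cvgZr_tmp; exact: ck].
Qed.

(** The last clause says that g runs along the gradient of the Busemann function
    of one of its ideal end points, which is what makes it length-minimising. *)
Definition unit_speed_line (g : R -> V * R) :=
  [/\ forall s, 0 < (g s).2, forall s, derivable g s 1,
      continuous (g^`()%classic), forall s, hyp_speed g s = 1 &
      exists xi, forall a b, `|ln (horo xi (g a)) - ln (horo xi (g b))| = `|a - b|].

(** Twice the hyperbolic cosine of the distance: up to the factor -2, the
    Lorentz form of the two points of the hyperboloid. *)
Definition pairing (p q : V * R) : R :=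
  (nsq (p.1 - q.1) + p.2 ^+ 2 + q.2 ^+ 2) / (p.2 * q.2).

(** The affine reparametrisation of g has length |a - b|, and no curve is
    shorter by [ln_horo_le_length]. *)
Lemma rho_on_line g x y a b : unit_speed_line g -> val x = g a -> val y = g b ->
  rho x y = `|a - b|.
Proof.
move=> [gpos dg cg sg [xi hxi]] xa yb.
rewrite /rho (_ : ereal_inf _ = `|a - b|%:E)//.
pose aff (s : R) := a + (b - a) * s.
have daff (s : R) : is_derive s 1 aff (b - a).
  by apply: is_derive_eq; rewrite /GRing.scale/=; ring.
pose c := g \o aff.
have dc (s : R) : is_derive s 1 c ((b - a) *: g^`()%classic (aff s)).
  have d1 : differentiable g (aff s) by apply/derivable1_diffP.
  have d2 : differentiable aff s by apply/derivable1_diffP; exact: ex_derive.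
  have d3 := differentiable_comp d2 d1.
  apply: DeriveDef; first exact: diff_derivable.
  rewrite deriveE// diff_comp//= -(@deriveE _ _ _ aff)//.
  rewrite (derive_val (df := b - a)).
  have -> : 'd g (aff s) (b - a) = (b - a) *: 'd g (aff s) 1.
    by rewrite -linearZ [_ *: 1]mulr1.
  by rewrite derive1E'.
have c'E : c^`()%classic = fun s => (b - a) *: g^`()%classic (aff s).
  by apply/funext => s; rewrite derive1E; exact: derive_val.
have ca : continuous aff.
  by move=> s; apply: cvgD; [exact: cvg_cst|apply: cvgM; [exact: cvg_cst|exact: cvg_id]].
have cP : C1_path x y c.
  split.
  - by move=> s; exact: ex_derive.
  - rewrite c'E => s; apply: cvgZl_tmp.
    by apply: (@cvg_comp _ _ _ aff _ _ _ _ (ca s)); exact: cg.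
  - by rewrite /c /aff /= mulr0 addr0.
  - by rewrite /c /aff /= mulr1 addrC subrK.
  - by move=> s _; exact: gpos.
have cL : hyp_length c = `|a - b|%:E.
  rewrite /hyp_length (eq_integral (cst `|a - b|%:E)); last first.
    move=> s _; congr EFin; rewrite /hyp_speed c'E/=.
    have := sg (aff s); rewrite /hyp_speed /GRing.scale/= !enorm_sqr nsqZ exprMn.
    rewrite -mulrDr sqrtrM ?sqr_ge0// sqrtr_sqr -mulrA => ->.
    by rewrite mulr1 distrC.
  by rewrite integral_cst//= lebesgue_measure_itv/= lte_fin ltr01 oppr0 adde0 mule1.
apply/eqP; rewrite eq_le; apply/andP; split.
  by apply: ereal_inf_lbound; exists c.
apply: le_ereal_inf_tmp => _ [d dP <-].
by have := ln_horo_le_length xi dP; rewrite xa yb hxi distrC.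
Qed.

Lemma vertical_line (v : V) : unit_speed_line (planar v 0 (fun=> 0) (@expR R)).
Proof.
have dg (s : R) : is_derive s 1 (planar v 0 (fun=> 0) (@expR R)) (0 *: 0, expR s).
  exact: is_derive_planar.
have g'E : (planar v 0 (fun=> 0) (@expR R))^`()%classic = planar 0 0 (fun=> 0) (@expR R).
  apply/funext => s; rewrite derive1E (derive_val (df := (0 *: 0, expR s)))//.
  by rewrite /planar add0r.
split.
- by move=> s; exact: expR_gt0.
- by move=> s; exact: ex_derive.
- by rewrite g'E; apply: continuous_planar; [move=> s; exact: cvg_cst|exact: continuous_expR].
- move=> s; rewrite /hyp_speed g'E /= enorm_sqr scaler0 addr0 nsq0 add0r.
  by rewrite sqrtr_sqr gtr0_norm ?expR_gt0// divff// gt_eqF// expR_gt0.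
- exists v => a b; congr `|_ - _|.
    by rewrite /horo/= scaler0 addr0 subrr nsq0 add0r expr2 mulfK ?gt_eqF ?expR_gt0// expRK.
  by rewrite /horo/= scaler0 addr0 subrr nsq0 add0r expr2 mulfK ?gt_eqF ?expR_gt0// expRK.
Qed.

Lemma pairing_vertical (v : V) a b :
  pairing (planar v 0 (fun=> 0) (@expR R) a) (planar v 0 (fun=> 0) (@expR R) b) =
  expR (a - b) + expR (b - a).
Proof.
rewrite /pairing/= !scaler0 subrr nsq0 add0r !expRD !expRN.
by have := expR_gt0 a; have := expR_gt0 b => A B; field; rewrite !gt_eqF.
Qed.

(** The half-circle (m + r tanh s u, r / cosh s), written with exponentials so
    that its derivatives and pairings are rational in exp s. *)
Section SemiCircle.
Variables (m u : V) (r : R).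
Hypotheses (r0 : 0 < r) (u1 : nsq u = 1).

Let k (s : R) : R := r * ((expR s ^+ 2 - 1) / (expR s ^+ 2 + 1)).
Let t (s : R) : R := r * (2 * expR s / (expR s ^+ 2 + 1)).
Let k' (s : R) : R := r * (4 * expR s ^+ 2 / (expR s ^+ 2 + 1) ^+ 2).
Let t' (s : R) : R := r * (2 * expR s * (1 - expR s ^+ 2) / (expR s ^+ 2 + 1) ^+ 2).

Definition semicircle : R -> V * R := planar m u k t.

Let den_gt0 (s : R) : 0 < expR s ^+ 2 + 1.
Proof. by rewrite ltr_wpDl// sqr_ge0. Qed.

Let dk (s : R) : is_derive s 1 k (k' s).
Proof.
have d0 : expR s ^+ 2 + 1 != 0 by rewrite gt_eqF.
have dV := @is_deriveV _ (fun s => expR s ^+ 2 + 1) s _ _ d0 _.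
apply: is_derive_eq.
rewrite /GRing.scale/= /k'; field; exact: d0.
Qed.

Let dt (s : R) : is_derive s 1 t (t' s).
Proof.
have d0 : expR s ^+ 2 + 1 != 0 by rewrite gt_eqF.
have dV := @is_deriveV _ (fun s => expR s ^+ 2 + 1) s _ _ d0 _.
apply: is_derive_eq.
rewrite /GRing.scale/= /t'; field; exact: d0.
Qed.

Lemma semicircle_line : unit_speed_line semicircle.
Proof.
have dg (s : R) : is_derive s 1 semicircle (k' s *: u, t' s).
  exact: is_derive_planar.
have g'E : semicircle^`()%classic = planar 0 u k' t'.
  apply/funext => s; rewrite derive1E (derive_val (df := (k' s *: u, t' s)))//.
  by rewrite /planar add0r.
have cd (s : R) : {for s, continuous (fun s : R => expR s ^+ 2 + 1)}.
  by apply/differentiable_continuous/derivable1_diffP; exact: ex_derive.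
have t0 s : 0 < t s by rewrite !mulr_gt0 ?expR_gt0// invr_gt0.
split.
- exact: t0.
- by move=> s; have [] := dg s.
- rewrite g'E; apply: continuous_planar => s.
    have d0 : (expR s ^+ 2 + 1) ^+ 2 != 0 by rewrite expf_neq0// gt_eqF.
    have dV := @is_deriveV _ (fun s => (expR s ^+ 2 + 1) ^+ 2) s _ _ d0 _.
    by apply/differentiable_continuous/derivable1_diffP; exact: ex_derive.
  have d0 : (expR s ^+ 2 + 1) ^+ 2 != 0 by rewrite expf_neq0// gt_eqF.
  have dV := @is_deriveV _ (fun s => (expR s ^+ 2 + 1) ^+ 2) s _ _ d0 _.
  by apply/differentiable_continuous/derivable1_diffP; exact: ex_derive.
- move=> s; rewrite /hyp_speed g'E /= enorm_sqr add0r nsqZ u1 mulr1.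
  have -> : k' s ^+ 2 + t' s ^+ 2 = t s ^+ 2.
    by rewrite /k' /t' /t; field; rewrite gt_eqF.
  by rewrite sqrtr_sqr gtr0_norm// divff// gt_eqF.
- exists (m + r *: u) => a b.
  have h s : ln (horo (m + r *: u) (semicircle s)) = ln (2 * r) - s.
    rewrite -[s in RHS]expRK -ln_div ?posrE ?mulr_gt0 ?expR_gt0//; congr ln.
    rewrite /horo/= opprD addrACA subrr add0r -scalerBl nsqZ u1 mulr1 /k /t.
    by field; rewrite !gt_eqF ?expR_gt0.
  by rewrite !h distrC; congr `|_|; ring.
Qed.

Lemma pairing_semicircle a b :
  pairing (semicircle a) (semicircle b) = expR (a - b) + expR (b - a).
Proof.
rewrite /pairing/= opprD addrACA subrr add0r -scalerBl nsqZ u1 mulr1 !expRD !expRN.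
by rewrite /k /t; field; rewrite !gt_eqF ?expR_gt0.
Qed.

Lemma semicircle_surj p h : 0 < h -> p ^+ 2 + h ^+ 2 = r ^+ 2 ->
  exists a, semicircle a = (m + p *: u, h).
Proof.
move=> h0 ph.
have /andP[rp' rp] : (0 < r + p) && (0 < r - p).
  have : `|p| < r.
    rewrite -(ltr_pXn2r (n := 2))// ?nnegrE ?normr_ge0 ?(ltW r0)//.
    by rewrite real_normK ?num_real// -ph ltrDl exprn_gt0.
  by rewrite ltr_norml => /andP[? ?]; apply/andP; split; lra.
have E0 : 0 < (r + p) / h by rewrite divr_gt0.
(* cosh s + sinh s, with cosh s = r / h and sinh s = p / h. *)
exists (ln ((r + p) / h)).
rewrite /semicircle /planar /k /t !lnK ?posrE//.
have hE : h ^+ 2 = (r - p) * (r + p) by rewrite -[LHS](addKr (p ^+ 2)) ph; ring.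
have -> : ((r + p) / h) ^+ 2 = (r + p) / (r - p).
  by rewrite expr_div_n hE; field; rewrite !gt_eqF.
congr (m + _ *: u, _); first by field; rewrite !gt_eqF//; lra.
have -> : (r + p) / (r - p) + 1 = 2 * r / (r - p).
  by field; rewrite !gt_eqF.
transitivity ((r - p) * (r + p) / h); first by field; rewrite !gt_eqF.
by rewrite -hE expr2 mulfK// gt_eqF.
Qed.

End SemiCircle.

(** Two points over different base points lie on the half-circle whose centre,
    at abscissa k on the line joining the base points, is equidistant from
    both. *)
Lemma on_line x y : exists g a b, [/\ unit_speed_line g, val x = g a, val y = g b &
  pairing (g a) (g b) = expR (a - b) + expR (b - a)].
Proof.
case: x y => -[v h] /= xP [[w l] /= yP].
have h0 : 0 < h by have /set_mem := xP.
have l0 : 0 < l by have /set_mem := yP.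
have [vw|vw] := eqVneq v w.
  exists (planar v 0 (fun=> 0) (@expR R)), (ln h), (ln l); split.
  - exact: vertical_line.
  - by rewrite /planar scaler0 addr0 lnK.
  - by rewrite /planar scaler0 addr0 lnK// vw.
  - exact: pairing_vertical.
pose d := Num.sqrt (nsq (w - v)).
have d0 : 0 < d by rewrite sqrtr_gt0 lt_neqAle nsq_ge0 eq_sym nsq_eq0 subr_eq0 eq_sym vw.
pose u := d^-1 *: (w - v).
have u1 : nsq u = 1.
  by rewrite nsqZ exprVn sqr_sqrtr ?nsq_ge0// mulVf// nsq_eq0 subr_eq0 eq_sym.
(* Solution of k^2 + h^2 = (d - k)^2 + l^2. *)
pose k := (d ^+ 2 + l ^+ 2 - h ^+ 2) / (2 * d).
pose r := Num.sqrt (k ^+ 2 + h ^+ 2).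
have kh : 0 < k ^+ 2 + h ^+ 2 by rewrite ltr_wpDl ?sqr_ge0// exprn_gt0.
have r0 : 0 < r by rewrite sqrtr_gt0.
have r2 : r ^+ 2 = k ^+ 2 + h ^+ 2 by rewrite sqr_sqrtr// ltW.
have hk : (- k) ^+ 2 + h ^+ 2 = r ^+ 2 by rewrite sqrrN.
have lk : (d - k) ^+ 2 + l ^+ 2 = r ^+ 2 by rewrite r2 /k; field; rewrite gt_eqF.
have [a ha] := semicircle_surj (v + k *: u) u r0 h0 hk.
have [b hb] := semicircle_surj (v + k *: u) u r0 l0 lk.
exists (semicircle (v + k *: u) u r), a, b; split.
- exact: semicircle_line.
- by rewrite ha scaleNr addrK.
- by rewrite hb -addrA -scalerDl [k + _]addrC subrK /u scalerA divff ?gt_eqF// scale1r addrC subrK.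
- exact: pairing_semicircle.
Qed.

Lemma pairing_rho x y :
  pairing (val x) (val y) = expR (rho x y) + expR (- rho x y).
Proof.
have [g [a [b [gl xa yb]]]] := on_line x y.
rewrite (rho_on_line gl xa yb) xa yb => ->.
have [ab|ab] := leP 0 (a - b); first by rewrite ger0_norm ?opprB.
by rewrite ltr0_norm// opprK opprB addrC.
Qed.

End Geodesics.

(** * Fixed points of nilpotent group actions *)

Section NilpotentActions.
Context {G : groupType}.
Implicit Types (A N : set G) (x y z : G).
Local Open Scope group_scope.

Lemma generated_subgroup A : is_subgroup (generated A).
Proof.
split; first by move=> N [[]].
- by move=> x y Ax Ay N [sN AN]; have [_ h _] := sN; apply: h; [exact: Ax|exact: Ay].
- by move=> x Ax N [sN AN]; have [_ _ h] := sN; apply: h; exact: Ax.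
Qed.

Lemma sub_generated A : A `<=` generated A.
Proof. exact: sub_smallest. Qed.

Lemma generated_sub A N : is_subgroup N -> A `<=` N -> generated A `<=` N.
Proof. by move=> sN AN x; apply. Qed.

Lemma subgroupX A x k : is_subgroup A -> A x -> A (x ^+ k).
Proof.
move=> [A1 AM _] Ax; elim: k => [|k IH]; first by rewrite expg0.
by rewrite expgS; exact: AM.
Qed.

(** Two of the cosets x^i N coincide. *)
Lemma finite_index_power A N x : is_subgroup N -> is_subgroup A ->
  finite_index A N -> A x -> exists2 k, (0 < k)%N & N (x ^+ k).
Proof.
move=> [N1 NM NV] sA fin Ax.
pose coset k := [set x ^+ k * y | y in N].
have [i [j [ij eqc]]] : exists i j, (i < j)%N /\ coset i = coset j.
  apply: contrapT => H.
  have inj : injective coset.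
    move=> i j eqc; apply/eqP; case: ltngtP => // ij; case: H.
      by exists i, j.
    by exists j, i.
  have /eq_finite_set fE := inj_card_eq (A := setT) (in2W inj).
  apply: infinite_nat; rewrite -fE.
  apply: (sub_finite_set _ fin) => _ [k _ <-].
  by exists (x ^+ k) => //; exact: subgroupX.
exists (j - i)%N; first by rewrite subn_gt0.
have : coset i (x ^+ j) by rewrite eqc; exists 1 => //; rewrite mulg1.
move=> [y Ny yE].
suff -> : x ^+ (j - i) = y by [].
by apply: (mulgI (x ^+ i)); rewrite yE -expgnDr subnKC// ltnW.
Qed.

Variables (T : Type) (act : G -> T -> T).
Hypothesis actM : forall x y t, act (x * y) t = act x (act y t).
Hypothesis act1 : forall t, act 1 t = t.

Lemma act_fixV x t : act x t = t -> act x^-1 t = t.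
Proof. by move=> {1}<-; rewrite -actM mulVg act1. Qed.

(** If t is fixed by p and [~ z, p], it is fixed by their combination
    z^-1 p^-1 z = [~ z, p] p^-1, so that p fixes z t. *)
Lemma commutator_fixed p z t : (forall s, act p s = s -> s = t) ->
  act p t = t -> act [~ z, p] t = t -> act z t = t.
Proof.
move=> fixp pt ct; apply: fixp.
have : act (z^-1 * p^-1 * z) t = t.
  have -> : z^-1 * p^-1 * z = [~ z, p] * p^-1.
    by rewrite commgEl conjgE !mulgA mulgK.
  by rewrite actM act_fixV.
move=> /(congr1 (act (p * z))); rewrite -actM !mulgA mulgK mulgV mul1g.
by rewrite actM.
Qed.

(** Downward induction along the series, starting from its trivial term. At
    j = 0 this says that t is fixed by all of N. *)
Lemma lower_central_fixed N p t k : is_subgroup N -> N p ->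
  (forall s, act p s = s -> s = t) -> act p t = t ->
  lower_central N k `<=` [set 1] ->
  forall j z, (j <= k)%N -> lower_central N j z -> act z t = t.
Proof.
move=> sN Np fixp pt Nk j z jk; move: j z jk.
suff H i : (i <= k)%N -> forall z, lower_central N (k - i) z -> act z t = t.
  by move=> j z jk Nz; apply: (H (k - j)%N); rewrite ?leq_subr// subKn.
elim: i => [_ z|i IH ik z Nz]; first by rewrite subn0 => /Nk ->.
apply: (commutator_fixed fixp) => //; apply: IH; first exact: ltnW.
rewrite -(subnSK ik)/=; apply: sub_generated.
by exists z => //; exists p.
Qed.

Lemma nilpotent_common_fixed_point N p q a b :
  is_subgroup N -> nilpotent_subgroup N -> N p -> N q ->
  (forall s, act p s = s <-> s = a) -> (forall s, act q s = s <-> s = b) -> a = b.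
Proof.
move=> sN [k Nk] Np Nq fixp fixq; apply/esym/(fixp b).1.
apply: (lower_central_fixed sN Nq _ _ Nk (leq0n k)) => //.
  by move=> s /fixq.
exact/fixq.
Qed.

End NilpotentActions.

(** * Convergence to ideal points *)

Section Boundary.
Context {R : realType} {n : nat}.
Local Notation V := ('rV[R]_n.-1).
Local Notation HH := (set_type (@upper_half_space R n)).
Implicit Types (x y z : HH) (v w : V) (xi eta : boundary R n) (f g : isom R n).

(** The exponential of the Busemann function of an ideal point; that of infinity
    is minus the logarithm of the height. *)
Definition horofun xi (p : V * R) : R := if xi is Some v then horo v p else p.2^-1.

Definition sqnorm (p : V * R) : R := nsq p.1 + p.2 ^+ 2.

Lemma horofun_gt0 xi x : 0 < horofun xi (val x).
Proof.
by case: xi => [v|]; [apply: horo_gt0|rewrite /= invr_gt0]; exact: height_gt0.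
Qed.

Lemma isom_pairing f x y : pairing (val (f x)) (val (f y)) = pairing (val x) (val y).
Proof. by rewrite !pairing_rho isom_rho. Qed.

(** The pairings of x with these points determine the coordinates of x, through
    linear expressions in 1 / t, v / t and |x|^2 / t. *)
Definition probe0 : HH := hpoint (0 : V) (@ltr01 R).
Definition probe2 : HH := hpoint (0 : V) (@ltr0Sn R 1).
Definition probe (i : 'I_n.-1) : HH := hpoint (delta_mx 0 i : V) (@ltr01 R).

Lemma pairing_probe0 x :
  pairing (val x) (val probe0) = (sqnorm (val x) + 1) / (val x).2.
Proof. by rewrite /pairing /= subr0 expr1n mulr1. Qed.

Lemma pairing_probe2 x :
  pairing (val x) (val probe2) = (sqnorm (val x) + 4) / (2 * (val x).2).
Proof.
by rewrite /pairing /= subr0 (mulrC 2); congr ((_ + _) / _); ring.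
Qed.

Lemma pairing_probe i x : pairing (val x) (val (probe i)) =
  (sqnorm (val x) + 2 - 2 * (val x).1 0 i) / (val x).2.
Proof.
rewrite /pairing /= mulr1 nsqD dotNl nsqN nsq_delta dotC dot_delta /sqnorm.
by congr (_ / _); ring.
Qed.

Lemma continuous_sqnorm : continuous (sqnorm : V * R -> R).
Proof.
move=> p.
have c1 : {for p, continuous (@fst V R)} by exact: cvg_fst.
have c2 : {for p, continuous (@snd V R)} by exact: cvg_snd.
have h1 := continuous_nsq c1.
have h2 : {for p, continuous (fun p : V * R => p.2 ^+ 2)}.
  by apply: (@cvg_comp _ _ _ snd (fun t : R => t ^+ 2) _ _ _ c2);
    exact: exprn_continuous.
exact: (cvgD h1 h2).
Qed.

Lemma compact_sqnorm_bounded (K : set (V * R)) : compact K ->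
  exists M, forall p, K p -> sqnorm p <= M.
Proof.
move=> cK; have : compact (sqnorm @` K).
  apply: continuous_compact => //; apply: continuous_subspaceT; exact: continuous_sqnorm.
move=> /compact_bounded [M [_ hB]]; exists (M + 1) => p Kp.
have := hB (M + 1); rewrite ltrDl ltr01 => /(_ isT (sqnorm p)).
move=> /(_ (ex_intro2 _ _ _ Kp erefl)) /=; exact/le_trans/ler_norm.
Qed.

Global Instance approach_filter xi : ProperFilter (approach xi).
Proof.
apply: filter_from_proper; last first.
  case: xi => [v|] U /=.
    move=> nU.
    have c0 : (v, t) @[t --> (0 : R)^'+] --> (v, 0 : R).
      have h1 : v @[_ --> (0 : R)^'+] --> v by exact: cvg_cst.
      have h2 : t @[t --> (0 : R)^'+] --> (0 : R) by exact/cvg_at_right_filter/cvg_id.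
      exact: (cvg_pair h1 h2).
    have H : \forall t \near (0 : R)^'+, U (Some (v, t)) by exact: c0 nU.
    have [t [t0 Ut]] : exists t : R, 0 < t /\ U (Some (v, t)).
      apply: (@filter_ex _ (0 : R)^'+); near=> t; split; near: t; last exact: H.
      exact: nbhs_right_gt.
    by exists (hpoint v t0).
  move=> [K [cK _] KU]; have [M hM] := compact_sqnorm_bounded cK.
  have t0 : 0 < `|M| + 1 :> R by rewrite ltr_wpDl.
  exists (hpoint 0 t0); apply: KU; left; exists (0, `|M| + 1) => // Kp.
  have := hM _ Kp; rewrite /sqnorm/= nsq0 add0r => h.
  have := ler_norm M; have : 0 <= `|M| by []; nra.
apply: filter_from_filter; first by exists setT; exact: filterT.
move=> A B nA nB; exists (A `&` B); first exact: filterI.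
by move=> x.
Unshelve. all: by end_near. Qed.

Lemma approach_Some v : val x @[x --> approach (Some v)] --> (v, 0 : R).
Proof.
move=> U nU; exists (Some @` U); first exact: one_point_compactification_some_nbhs.
by move=> x [p Up] [pE]; move: Up; rewrite pE.
Qed.

Lemma compact_sqnorm (M : R) : compact [set p : V * R | sqnorm p <= M].
Proof.
have cA : compact [set v : V | nsq v <= M].
  apply: bounded_closed_compact.
    exists (M + 1); split; first exact: num_real.
    move=> r Mr v /= vM; rewrite /Num.norm/= mx_normrE.
    apply: bigmax_le; first by have := nsq_ge0 v; lra.
    move=> [i j] _ /=; rewrite ord1.
    have := nsq_coord v j; rewrite -real_normK ?num_real//.
    have : 0 <= `|v 0 j| by [].
    nra.
  have : closed [set t : R | t <= M] by exact: closed_le.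
  by move/closed_comp; apply => v _; exact: continuous_nsq.
have cB : compact `[- (M + 1), M + 1] by exact: segment_compact.
apply: (subclosed_compact _ (compact_setX cA cB)).
  have : closed [set t : R | t <= M] by exact: closed_le.
  by move/closed_comp; apply => v _; exact: continuous_sqnorm.
move=> [v t]/=; rewrite /sqnorm/= in_itv/= => h; have := nsq_ge0 v; have := sqr_ge0 t.
split; first lra.
apply/andP; split; nra.
Qed.

Lemma approach_None (M : R) : \forall x \near approach None, M < sqnorm (val x).
Proof.
exists ((Some @` (~` [set p : V * R | sqnorm p <= M])) `|` [set None]).
  exists [set p : V * R | sqnorm p <= M] => //; split; first exact: compact_sqnorm.
  have : closed [set t : R | t <= M] by exact: closed_le.
  by move/closed_comp; apply => v _; exact: continuous_sqnorm.
by move=> x [[p /= /negP]|//]; rewrite -ltNge => hp [pE]; move: hp; rewrite pE.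
Qed.

Lemma cvg_of_interior_None (T : Type) (F : set_system T) (FF : Filter F) (h : T -> HH) :
  (forall M, \forall x \near F, M < sqnorm (val (h x))) ->
  of_interior (h x) @[x --> F] --> of_boundary (None : boundary R n).
Proof.
move=> hM U [K [cK _] KU].
have [M hK] := compact_sqnorm_bounded cK.
apply: filterS (hM M) => x hx; apply: KU; left; exists (val (h x)) => //= Kx.
by have := hK _ Kx; rewrite leNgt hx.
Qed.

Lemma cvg_of_interior_Some (T : Type) (F : set_system T) (FF : Filter F)
    (h : T -> HH) v :
  (forall i, (val (h x)).1 0 i @[x --> F] --> v 0 i) ->
  (val (h x)).2 @[x --> F] --> (0 : R) ->
  of_interior (h x) @[x --> F] --> of_boundary (Some v : boundary R n).
Proof.
move=> h1 h2.
have h3 : (val (h x)).1 @[x --> F] --> v.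
  apply/cvgrPdist_le => e e0.
  have : \forall x \near F, forall i, `|v 0 i - (val (h x)).1 0 i| <= e.
    by apply: filter_forall => i; move/cvgrPdist_le : (h1 i); apply.
  apply: filterS => x hx; rewrite /Num.norm/= mx_normrE.
  by apply: bigmax_le => [|[i j] _]; [exact: ltW|rewrite !mxE /= ord1].
have h4 : val (h x) @[x --> F] --> (v, 0 : R).
  apply: cvg_trans (cvg_pair h3 h2); apply: near_eq_cvg; apply: nearW => s.
  by rewrite -surjective_pairing.
move=> U nU; exact: (h4 (fun p => U (Some p)) nU).
Qed.

(** Coordinates grow at most like the square root of sqnorm. *)
Lemma cvg_div_sqnorm (T : Type) (F : set_system T) (FF : Filter F)
    (h : T -> HH) (a : T -> R) :
  (forall M, \forall x \near F, M < sqnorm (val (h x))) ->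
  (forall s, a s ^+ 2 <= sqnorm (val (h s))) ->
  a x / sqnorm (val (h x)) @[x --> F] --> (0 : R).
Proof.
move=> hM ha.
apply/cvgrPdist_le => e e0; have := hM (e ^- 2); apply: filterS => x hx.
have q0 : 0 < sqnorm (val (h x)) by apply: lt_trans hx; rewrite invr_gt0 exprn_gt0.
rewrite sub0r normrN normrM normfV (gtr0_norm q0) ler_pdivrMr//.
rewrite -(ler_pXn2r (n := 2)) ?nnegrE ?normr_ge0 ?mulr_ge0 ?(ltW e0) ?(ltW q0)//.
rewrite real_normK ?num_real//.
apply: le_trans (ha x) _.
rewrite exprMn [in leRHS]expr2 [sqnorm _ ^+ 2]expr2 mulrA ler_peMl ?(ltW q0)//.
by rewrite -expr2 -ler_pdivrMl ?exprn_gt0// mulr1 ltW.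
Qed.

Lemma cvg_dot_coord (T : Type) (F : set_system T) (FF : Filter F) (h : T -> V) v w :
  (forall i, h x 0 i @[x --> F] --> v 0 i) -> dot (h x) w @[x --> F] --> dot v w.
Proof.
move=> hi; apply: cvg_big => [|i _]; first exact: add_continuous.
by apply: cvgM => //; exact: cvg_cst.
Qed.

(** The scale tau is t near a finite point and t / |x|^2 near infinity. *)
Lemma approach_scale xi : exists tau : HH -> R,
  [/\ forall x, 0 < tau x, tau x @[x --> approach xi] --> (0 : R) &
      forall y, tau x * pairing (val x) (val y) @[x --> approach xi] --> horofun xi (val y)].
Proof.
case: xi => [v|].
  have A := @approach_Some v.
  have A2 : (val x).2 @[x --> approach (Some v)] --> (0 : R).
    exact: (cvg_comp _ _ A (@cvg_snd _ _ _ _ _)).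
  exists (fun x => (val x).2); split => // [x|y]; first exact: height_gt0.
  have y0 := height_gt0 y.
  rewrite (_ : (fun x => _ * _) = fun x =>
    (nsq ((val x).1 - (val y).1) + (val x).2 ^+ 2 + (val y).2 ^+ 2)
      / (val y).2); last first.
    apply/funext => x; have x0 := height_gt0 x; rewrite /pairing.
    by field; rewrite !gt_eqF.
  have A1 : (val x).1 - (val y).1 @[x --> approach (Some v)] --> v - (val y).1.
    by apply: cvgB; [exact: (cvg_comp _ _ A (@cvg_fst _ _ _ _ _))|exact: cvg_cst].
  have A3 : nsq ((val x).1 - (val y).1) @[x --> approach (Some v)] --> nsq (v - (val y).1).
    have cn : {for v - (val y).1, continuous (fun w : V => nsq w)}.
      by apply: (@continuous_nsq _ _ _ (fun w : V => w)); exact: cvg_id.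
    exact: (cvg_comp _ _ A1 cn).
  have A4 : (val x).2 ^+ 2 @[x --> approach (Some v)] --> (0 : R) ^+ 2.
    exact: (cvgM A2 A2).
  rewrite /= /horo nsqBC -[nsq _]addr0 -[X in _ + X + _](expr0n _ 2).
  apply: cvgM; last exact: cvg_cst.
  by apply: cvgD; [exact: cvgD|exact: cvg_cst].
have N := approach_None.
have q0 x : 0 < sqnorm (val x).
  by rewrite ltr_wpDl ?nsq_ge0// exprn_gt0 ?height_gt0.
have B2 : (val x).2 / sqnorm (val x) @[x --> approach None] --> (0 : R).
  by apply: (cvg_div_sqnorm _ (h := id)) => // x; rewrite lerDr nsq_ge0.
have B1 (i : 'I_n.-1) : (fun x : HH => (val x).1 0 i / sqnorm (val x)) @ approach None --> (0 : R).
  apply: (cvg_div_sqnorm _ (h := id)) => // x.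
  by rewrite (le_trans (nsq_coord _ i))// lerDl sqr_ge0.
have B0 : (sqnorm (val x))^-1 @[x --> approach None] --> (0 : R).
  apply/cvgrPdist_le => e e0; apply: filterS (N e^-1) => x ex.
  by rewrite sub0r normrN gtr0_norm ?invr_gt0// -[e]invrK lef_pV2 ?posrE ?invr_gt0// ltW.
exists (fun x => (val x).2 / sqnorm (val x)); split => // [x|y].
  by rewrite divr_gt0 ?height_gt0.
have y0 := height_gt0 y.
rewrite (_ : (fun x => _ * _) = fun x =>
   (1 + sqnorm (val y) * (sqnorm (val x))^-1
    - 2 * dot ((sqnorm (val x))^-1 *: (val x).1) (val y).1) / (val y).2); last first.
  apply/funext => x; have x0 := height_gt0 x; have := q0 x.
  have -> : pairing (val x) (val y) = (sqnorm (val x) + sqnorm (val y)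
     - 2 * dot (val x).1 (val y).1) / ((val x).2 * (val y).2).
    by congr (_ / _); rewrite /sqnorm /nsq !dotE (dotC (val y).1 (val x).1); ring.
  move: (sqnorm (val x)) => q q1; rewrite dotZl.
  by field; rewrite !gt_eqF.
have D : dot ((sqnorm (val x))^-1 *: (val x).1) (val y).1 @[x --> approach None]
    --> dot (0 : V) (val y).1.
  apply: cvg_dot_coord => i; rewrite mxE.
  apply: cvg_trans (B1 i); apply: near_eq_cvg; apply: nearW => x.
  by rewrite mxE mulrC.
have -> : horofun None (val y) = (1 + sqnorm (val y) * 0 - 2 * dot (0 : V) (val y).1) / (val y).2.
  rewrite -[0 : V](scale0r 0) dotZl mulr0 addr0 mul0r mulr0 subr0 mul1r//.
apply: cvgM; last exact: cvg_cst.
apply: cvgB; last by apply: cvgM => //; exact: cvg_cst.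
by apply: cvgD; [exact: cvg_cst|apply: cvgM => //; exact: cvg_cst].
Qed.

End Boundary.

(** * The action on ideal points *)

Section BoundaryAction.
Context {R : realType} {n : nat}.
Local Notation V := ('rV[R]_n.-1).
Local Notation HH := (set_type (@upper_half_space R n)).
Implicit Types (x y z : HH) (v w : V) (xi eta : boundary R n) (f g : isom R n).

Lemma isom_pairing_inv f x z : pairing (val (f x)) (val z) = pairing (val x) (val (isom_inv f z)).
Proof. by rewrite -{1}(isomVK f z) isom_pairing. Qed.

(** With (v', t') = f x and Q = |f x|^2, invariance of the pairing makes
    alpha = tau / t', alpha * Q and alpha * v' converge along xi, because they are
    linear combinations of the scaled pairings of f x with the probes. If the
    limit of alpha is not 0, then v' converges and t' = tau / alpha tends to 0; if
    it is 0, then Q tends to infinity, as alpha * (Q + 1) has a positive limit. *)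
Lemma bdry_limit_exists f xi : exists eta : boundary R n,
  of_interior (f x) @[x --> approach xi] --> of_boundary eta.
Proof.
have [tau [tau0 ctau cpair]] := approach_scale xi.
pose L z := horofun xi (val (isom_inv f z)).
have cL z : tau x * pairing (val (f x)) (val z) @[x --> approach xi] --> L z.
  by under eq_fun do rewrite isom_pairing_inv; exact: cpair.
pose alpha x := tau x / (val (f x)).2.
have alpha0 x : 0 < alpha x by rewrite divr_gt0// height_gt0.
have e0 x : tau x * pairing (val (f x)) (val probe0) =
    alpha x * (sqnorm (val (f x)) + 1).
  by rewrite pairing_probe0 mulrA mulrAC.
have e2 x : tau x * pairing (val (f x)) (val probe2) =
    alpha x * (sqnorm (val (f x)) + 4) / 2.
  have h := height_gt0 (f x); rewrite pairing_probe2 /alpha.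
  by field; rewrite gt_eqF.
have ei i x : tau x * pairing (val (f x)) (val (probe i)) =
    alpha x * (sqnorm (val (f x)) + 2 - 2 * (val (f x)).1 0 i).
  by rewrite pairing_probe mulrA mulrAC.
pose a := (2 * L probe2 - L probe0) / 3.
have calpha : alpha x @[x --> approach xi] --> a.
  have : (2 * (tau x * pairing (val (f x)) (val probe2)) -
    tau x * pairing (val (f x)) (val probe0)) / 3 @[x --> approach xi] --> a.
    by apply: cvgM; [apply: cvgB => //; apply: cvgM => //; exact: cvg_cst|exact: cvg_cst].
  apply: cvg_trans; apply: near_eq_cvg; apply: nearW => x.
  by rewrite e0 e2; field.
have cq : alpha x * sqnorm (val (f x)) @[x --> approach xi] --> L probe0 - a.
  have : tau x * pairing (val (f x)) (val probe0) - alpha x @[x --> approach xi] --> L probe0 - a.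
    exact: cvgB.
  apply: cvg_trans; apply: near_eq_cvg; apply: nearW => x.
  by rewrite e0; ring.
have cv (i : 'I_n.-1) : (fun x => alpha x * (val (f x)).1 0 i) @ approach xi -->
    (L probe0 + a - L (probe i)) / 2.
  have : (tau x * pairing (val (f x)) (val probe0) + alpha x -
     tau x * pairing (val (f x)) (val (probe i))) / 2 @[x --> approach xi] -->
     (L probe0 + a - L (probe i)) / 2.
    by apply: cvgM; [apply: cvgB => //; exact: cvgD|exact: cvg_cst].
  apply: cvg_trans; apply: near_eq_cvg; apply: nearW => x.
  by rewrite e0 ei; field.
have [a0|a0] := eqVneq a 0.
  exists None; apply: cvg_of_interior_None => M.
  have L0 : 0 < L probe0 by exact: horofun_gt0.
  rewrite a0 subr0 in cq; rewrite a0 in calpha.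
  have M0 : 0 < `|M| + 1 :> R by rewrite ltr_wpDl.
  have d0 : 0 < L probe0 / 2 / (`|M| + 1) by rewrite !divr_gt0.
  have h1 : \forall x \near approach xi, alpha x < L probe0 / 2 / (`|M| + 1).
    exact: (cvgr_lt _ calpha).
  have h2 : \forall x \near approach xi, L probe0 / 2 < alpha x * sqnorm (val (f x)).
    by apply: (cvgr_gt _ cq); lra.
  apply: filterS2 h1 h2 => x h1 h2.
  rewrite ltr_pdivlMr// in h1; have := lt_trans h1 h2; rewrite ltr_pM2l//; apply: le_lt_trans.
  by rewrite (le_trans (ler_norm _))// lerDl.
exists (Some (\row_i ((L probe0 + a - L (probe i)) / 2 / a))).
apply: cvg_of_interior_Some => [i|].
  rewrite mxE.
  have : (fun x => alpha x * (val (f x)).1 0 i / alpha x) @ approach xi -->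
    (L probe0 + a - L (probe i)) / 2 / a.
    by apply: cvgM => //; exact: cvgV.
  apply: cvg_trans; apply: near_eq_cvg; apply: nearW => x.
  by rewrite mulrAC divff ?mul1r// gt_eqF.
have : tau x / alpha x @[x --> approach xi] --> 0 / a.
  by apply: cvgM => //; exact: cvgV.
rewrite mul0r; apply: cvg_trans; apply: near_eq_cvg; apply: nearW => x.
by rewrite /alpha invfM invrK mulrA divff ?mul1r// gt_eqF.
Qed.

Lemma bdry_cvg f xi :
  of_interior (f x) @[x --> approach xi] --> of_boundary (bdry f xi).
Proof.
have [eta h] := bdry_limit_exists f xi.
exact: (@xgetI _ _ [set eta : boundary R n |
  of_interior (f x) @[x --> approach xi] --> of_boundary eta] eta h).
Qed.

(** The ratio of the pairings of x with y and z tends to the ratio of the values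
    of horofun xi; compute the same limit after applying f, where f x approaches
    the image of xi. *)
Lemma horofun_bdry f xi : exists2 c, 0 < c &
  forall y, horofun xi (val y) = c * horofun (bdry f xi) (val (f y)).
Proof.
have [tau [tau0 ctau cpair]] := approach_scale xi.
have [tau' [tau'0 ctau' cpair']] := approach_scale (bdry f xi).
have fcvg : f x @[x --> approach xi] --> approach (bdry f xi).
  move=> U [W nW WU]; 
  have H : \forall x \near approach xi, W (of_interior (f x)) by exact: bdry_cvg.
  change (\forall x \near approach xi, U (f x)).
  by apply: filterS H => x; exact: WU.
have cf y : tau' (f x) * pairing (val x) (val y) @[x --> approach xi] -->
    horofun (bdry f xi) (val (f y)).
  have := cvg_comp _ _ fcvg (cpair' (f y)); apply: cvg_trans.
  apply: near_eq_cvg; apply: nearW => x /=.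
  by rewrite isom_pairing.
have key y z : horofun xi (val y) * horofun (bdry f xi) (val (f z)) =
   horofun (bdry f xi) (val (f y)) * horofun xi (val z).
  have FF : Filter (approach xi) by exact: filter_filter.
  have /(_ FF) h1 := cvgM (cpair y) (cf z).
  have /(_ FF) h2 := cvgM (cf y) (cpair z).
  apply: (norm_cvg_unique h1).
  apply: cvg_trans h2; apply: near_eq_cvg; apply: nearW => x.
  by rewrite /=; ring.
exists (horofun xi (val probe0) / horofun (bdry f xi) (val (f probe0))).
  by rewrite divr_gt0 ?horofun_gt0.
move=> y; rewrite mulrAC [X in _ = X / _]mulrC -key mulfK// gt_eqF ?horofun_gt0//.
Qed.

(** On the vertical line over a finite point, its own horofunction is
    proportional to the height s, the one of infinity to 1 / s, and the one of
    another point to neither; two heights detect this. *)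
Lemma horofun_inj xi eta c :
  (forall y, horofun xi (val y) = c * horofun eta (val y)) -> xi = eta.
Proof.
have lt02 : 0 < 2 :> R by [].
case: xi eta => [v|] [w|] //= H.
- have := H (hpoint v (@ltr01 R)); have := H (hpoint v lt02).
  rewrite /horo/= subrr nsq0 => h1 h2.
  have /eqP : nsq (v - w) = 0 by nra.
  by rewrite nsq_eq0 subr_eq0 => /eqP ->.
- have := H (hpoint v (@ltr01 R)); have := H (hpoint v lt02).
  by rewrite /horo/= subrr nsq0 => h1 h2; exfalso; lra.
- have := H (hpoint w (@ltr01 R)); have := H (hpoint w lt02).
  by rewrite /horo/= subrr nsq0 => h1 h2; exfalso; lra.
Qed.

Lemma bdry_eq f xi eta c :
  (forall y, horofun xi (val y) = c * horofun eta (val (f y))) -> bdry f xi = eta.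
Proof.
move=> H; have [d d0 Hd] := horofun_bdry f xi.
apply: (@horofun_inj _ _ (d^-1 * c)) => y.
have := Hd (isom_inv f y); rewrite isomVK => e.
by rewrite -[y in RHS](isomVK f) -mulrA -H e mulKf// gt_eqF.
Qed.

Lemma bdryM f g xi : bdry (f * g)%g xi = bdry f (bdry g xi).
Proof.
have [c c0 Hc] := horofun_bdry g xi; have [d d0 Hd] := horofun_bdry f (bdry g xi).
by apply: (@bdry_eq _ _ _ (c * d)) => y; rewrite Hc Hd mulrA.
Qed.

Lemma bdry1 xi : bdry (1%g : isom R n) xi = xi.
Proof. by apply: (@bdry_eq _ _ _ 1) => y; rewrite mul1r. Qed.

End BoundaryAction.

(** * Orientation-preserving isometries form a group *)

Section Differentiability.
Context {R : realType}.

Lemma near_eq_differentiable (V W : normedModType R) (f g : V -> W) (x : V) :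
  (\forall y \near x, f y = g y) -> differentiable f x ->
  differentiable g x /\ 'd g x = 'd f x :> (V -> W).
Proof.
move=> fg df.
have gfx : g x = f x by rewrite (nbhs_singleton fg).
have dfc : continuous ('d f x) by have [] := (diff_locallyP x f).1 df.
have key : g \o shift x = cst (g x) + 'd f x +o_ (0 : V) id.
  have [_ /eqaddoP h] := (diff_locallyP x f).1 df.
  apply/eqaddoP => e e0; have {}h := h e e0.
  have fg0 : \forall z \near (0 : V), f (z + x) = g (z + x).
    move: fg; rewrite (near_shift 0 x) => h1; apply: filterS h1 => z /=.
    by rewrite subr0.
  by apply: filterS2 fg0 h => z fgz; rewrite gfx !fctE /= fgz.
have dE : 'd g x = 'd f x :> (V -> W) by exact: diff_unique.
split; last exact: dE.
by apply/diff_locallyP; rewrite dE; split; [exact: dfc|exact: key].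
Qed.

Lemma differentiable_row (V : normedModType R) m (F : V -> 'rV[R]_m) (x : V) :
  (forall j, differentiable (fun y => F y 0 j) x) -> differentiable F x.
Proof.
move=> dF.
have -> : F = \sum_j (fun y => F y 0 j *: delta_mx 0 j).
  by apply/funext => y; rewrite fct_sumE -row_sum_delta.
by apply: differentiable_sum => j; exact: differentiableZl.
Qed.

Lemma jacobian_comp m1 m2 m3 (f : 'rV[R]_m1 -> 'rV[R]_m2) (g : 'rV[R]_m2 -> 'rV[R]_m3) x :
  differentiable f x -> differentiable g (f x) ->
  'J (g \o f) x = 'J f x *m 'J g (f x).
Proof.
move=> df dg; apply/row_matrixP => i; rewrite row_mul !rowE.
by rewrite !mul_rV_lin1 /= diff_comp.
Qed.

End Differentiability.

Section Orientation.
Context {R : realType} {n : nat}.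
Local Notation V := ('rV[R]_n.-1).
Local Notation HH := (set_type (@upper_half_space R n)).
Implicit Types (x y z : HH) (v w : V) (f g h : isom R n).

Lemma flatK : cancel (@flat R n) (@unflat R n).
Proof. by case=> v t; rewrite /unflat /flat row_mxKl row_mxKr mxE eqxx mulr1n. Qed.

Lemma unflatK : cancel (@unflat R n) (@flat R n).
Proof.
move=> y; rewrite /flat /unflat /= -[RHS]hsubmxK; congr row_mx.
by apply/rowP => i; rewrite !mxE !ord1 eqxx mulr1n.
Qed.

Lemma flat_isomE f x : flat_isom f (flat (val x)) = flat (val (f x)).
Proof. by rewrite /flat_isom flatK valK. Qed.

Lemma flat_isomM f g : flat_isom (f * g)%g = flat_isom f \o flat_isom g.
Proof.
apply/funext => y /=; rewrite {1 3}/flat_isom; case: insubP => [x _ xy|_] /=.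
  by rewrite flat_isomE.
rewrite /flat_isom insubF// /unflat; apply/negP => /set_mem.
by rewrite /upper_half_space/= !mxE ltxx.
Qed.

(** A property of the flattened half-space, which is open, holds near each of its
    points. *)
Lemma near_half_space x (P : 'rV[R]_(n.-1 + 1) -> Prop) :
  (forall y, P (flat (val y))) -> \forall p \near flat (val x), P p.
Proof.
move=> HP.
have c : {for flat (val x), continuous (fun p : 'rV[R]_(n.-1 + 1) => p 0 (rshift n.-1 0))}.
  exact: coord_continuous.
have h : 0 < flat (val x) 0 (rshift n.-1 0).
  by rewrite row_mxEr mxE eqxx mulr1n height_gt0.
have h' : \forall p \near flat (val x), 0 < (p : 'rV[R]_(n.-1 + 1)) 0 (rshift n.-1 0).
  exact: (cvgr_gt _ c).
apply: filterS h' => p p0.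
have p0' : 0 < (unflat p).2 by rewrite /unflat/= mxE.
rewrite -(unflatK p); exact: HP (hpoint (unflat p).1 p0').
Qed.

Lemma differentiable_pairing (z : HH) (p : 'rV[R]_(n.-1 + 1)) : 0 < (unflat p).2 ->
  differentiable (fun q => pairing (unflat q) (val z)) p.
Proof.
move=> p0.
pose r (q : 'rV[R]_(n.-1 + 1)) : R := q 0 (rshift n.-1 0).
pose l i (q : 'rV[R]_(n.-1 + 1)) : R := q 0 (lshift 1 i) - (val z).1 0 i.
have E : (fun q => pairing (unflat q) (val z)) =
    fun q => ((\sum_i (l i * l i)) q + r q * r q + (val z).2 ^+ 2) *
             (r q * (val z).2)^-1.
  apply/funext => q; rewrite fct_sumE /pairing /unflat/= !mxE -expr2.
  by congr ((_ + _ + _) / _); apply: eq_bigr => i _; rewrite !mxE.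
have dr : differentiable r p by exact: differentiable_coord.
have dl i : differentiable (l i) p.
  by apply: differentiableB; [exact: differentiable_coord|exact: differentiable_cst].
rewrite E; apply: differentiableM.
  apply: differentiableD; last exact: differentiable_cst.
  apply: differentiableD; last exact: (differentiableM dr dr).
  by apply: differentiable_sum => i; exact: differentiableM.
apply: differentiableV.
  exact: (differentiableM dr (differentiable_cst _ _)).
rewrite mulf_neq0 ?(gt_eqF (height_gt0 z))//.
by move: p0; rewrite /unflat/= mxE -/(r p) => p0; rewrite gt_eqF.
Qed.

(** The pairings of f x with the probes are the pairings of x with fixed points,
    hence rational in x; so are the coordinates of f x. *)
Lemma flat_isom_differentiable f x : differentiable (flat_isom f) (flat (val x)).
Proof.
pose P z q := pairing (unflat q) (val (isom_inv f z)).
have PE z y : P z (flat (val y)) = pairing (val (f y)) (val z).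
  by rewrite /P flatK isom_pairing_inv.
pose q0 := flat (val x).
have dP z : differentiable (P z) q0.
  by apply: differentiable_pairing; rewrite flatK height_gt0.
pose T q := 3 / (2 * P probe2 q - P probe0 q).
have TE y : T (flat (val y)) = (val (f y)).2.
  have h := height_gt0 (f y).
  rewrite /T !PE pairing_probe0 pairing_probe2.
  have -> : 2 * ((sqnorm (val (f y)) + 4) / (2 * (val (f y)).2)) -
      (sqnorm (val (f y)) + 1) / (val (f y)).2 = 3 / (val (f y)).2.
    by field; rewrite gt_eqF.
  by rewrite invfM invrK mulrA divff ?mul1r.
have TN0 : 2 * P probe2 q0 - P probe0 q0 != 0.
  have : T q0 != 0 by rewrite TE gt_eqF ?height_gt0.
  by rewrite /T mulf_eq0 invr_eq0 negb_or => /andP[].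
have dT : differentiable T q0.
  apply: (differentiableM (differentiable_cst (3 : R) q0)); apply: differentiableV => //.
  by apply: differentiableB => //; exact: (differentiableM (differentiable_cst (2 : R) q0)).
apply: differentiable_row => j.
have [i ji|i ji] := splitP j.
  have -> : j = lshift 1 i by exact: val_inj.
  pose C q := (P probe0 q + (T q)^-1 - P (probe i) q) / 2 * T q.
  have CE y : C (flat (val y)) = (val (f y)).1 0 i.
    have h := height_gt0 (f y).
    rewrite /C TE !PE pairing_probe0 pairing_probe.
    by field; rewrite gt_eqF.
  have dC : differentiable C q0.
    apply: differentiableM => //.
    apply: (@differentiableM _ _ _ (cst 2^-1)); last exact: differentiable_cst.
    apply: differentiableB => //; apply: differentiableD => //.
    by apply: differentiableV => //; rewrite TE gt_eqF ?height_gt0.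
  have [] // := @near_eq_differentiable _ _ _ C (fun q => flat_isom f q 0 (lshift 1 i)) q0 _ dC.
  by apply: near_half_space => y; rewrite CE flat_isomE /flat row_mxEl.
have -> : j = rshift n.-1 0 by apply: val_inj; rewrite /= ji ord1.
have [] // := @near_eq_differentiable _ _ _ T (fun q => flat_isom f q 0 (rshift n.-1 0)) q0 _ dT.
by apply: near_half_space => y; rewrite TE flat_isomE /flat row_mxEr mxE eqxx mulr1n.
Qed.

Lemma jacobian_flat1 x : 'J (flat_isom (1%g : isom R n)) (flat (val x)) = 1%:M.
Proof.
have [_ dE] := @near_eq_differentiable _ _ _ id (flat_isom (1%g : isom R n)) (flat (val x))
  (near_half_space (P := fun q => id q = flat_isom 1%g q) x (fun y => esym (flat_isomE 1%g y)))
  (linear_differentiable (f := idfun) _ (fun=> cvg_id)).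
apply/row_matrixP => i; rewrite !rowE mul_rV_lin1 /= dE mulmx1.
have := @diff_lin _ _ _ (idfun : {linear 'rV[R]_(n.-1 + 1) -> _}) (flat (val x)) (fun=> cvg_id).
by move=> ->.
Qed.

Lemma jacobian_flatM f g x : 'J (flat_isom (f * g)%g) (flat (val x)) =
  'J (flat_isom g) (flat (val x)) *m 'J (flat_isom f) (flat (val (g x))).
Proof.
rewrite flat_isomM jacobian_comp ?flat_isomE//; exact: flat_isom_differentiable.
Qed.

(** By the chain rule; for inverses the two Jacobian determinants have product
    1. *)
Lemma Isom_plus_subgroup : is_subgroup (@Isom_plus R n).
Proof.
split.
- by move=> x; split; [exact: flat_isom_differentiable|rewrite jacobian_flat1 det1].
- move=> f g hf hg x; split; first exact: flat_isom_differentiable.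
  by rewrite jacobian_flatM det_mulmx mulr_gt0//; [have [] := hg x|have [] := hf (g x)].
- move=> f hf x; split; first exact: flat_isom_differentiable.
  have [_ d0] := hf (f^-1%g x).
  have := congr1 determinant (jacobian_flatM f f^-1%g x).
  rewrite mulgV jacobian_flat1 det1 det_mulmx => e.
  by rewrite -(pmulr_lgt0 _ d0) -e.
Qed.

End Orientation.

(** * Euclidean similarities and their fixed points *)

(** Lets the contraction principle apply to spaces of row vectors. *)
HB.instance Definition _ (R : realType) (m k : nat) := Complete.on 'M[R]_(m, k).

Section Similarities.
Context {R : realType} {m : nat}.
Implicit Types (u v w : 'rV[R]_m).

Lemma sup_norm_sqr_le v : `|v| ^+ 2 <= nsq v.
Proof.
rewrite -[leRHS]sqr_sqrtr ?nsq_ge0// ler_pXn2r ?nnegrE ?sqrtr_ge0//.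
rewrite [leLHS]/Num.norm/= mx_normrE; apply: bigmax_le; first exact: sqrtr_ge0.
move=> [i j] _ /=; rewrite ord1 -sqrtr_sqr ler_wsqrtr//; exact: nsq_coord.
Qed.

Lemma nsq_le_sup_norm v : nsq v <= m%:R * `|v| ^+ 2.
Proof.
have -> : m%:R * `|v| ^+ 2 = \sum_(i < m) `|v| ^+ 2 by rewrite sumr_const card_ord mulr_natl.
apply: ler_sum => i _; rewrite -expr2 -[leLHS]real_normK ?num_real//.
rewrite ler_pXn2r ?nnegrE// [leRHS]/Num.norm/= mx_normrE.
exact: (le_trans _ (le_bigmax _ _ (0, i))).
Qed.

(** The sup norm and the Euclidean norm are equivalent, so some iterate of phi is
    a contraction for the sup norm; phi moves the fixed point of this iterate to
    another one, and there is only one. *)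
Lemma similarity_fixed_point (c : R) (phi : 'rV[R]_m -> 'rV[R]_m) : 0 < c < 1 ->
  (forall v w, nsq (phi v - phi w) = c ^+ 2 * nsq (v - w)) -> exists v, phi v = v.
Proof.
move=> /andP[c0 c1] hphi.
have hiter k v w : nsq (iter k phi v - iter k phi w) = c ^+ 2 ^+ k * nsq (v - w).
  by elim: k => [|k IH]; rewrite ?mul1r//= hphi IH mulrA -exprS.
have cc : `|c ^+ 2| < 1 by rewrite ger0_norm ?sqr_ge0// expr_lt1// ltW.
(* 4^-1 is the square of the contraction factor 2^-1 used below. *)
have [k k0 hk] : exists2 k, (0 < k)%N & c ^+ 2 ^+ k * m%:R <= 4^-1.
  have h : (fun k => c ^+ 2 ^+ k * m%:R) @ \oo --> (0 * m%:R : R).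
    by apply: cvgM; [exact: cvg_expr|exact: cvg_cst].
  rewrite mul0r in h.
  have : \forall k \near \oo, c ^+ 2 ^+ k * m%:R < 4^-1 by apply: (cvgr_lt _ h).
  by move=> [k _ /(_ k.+1 (leqnSn k)) ?]; exists k.+1 => //; exact: ltW.
have half0 : (0 : R) <= 2^-1 by [].
pose f : {fun [set: 'rV[R]_m] >-> [set: 'rV[R]_m]} := [fun of totalfun (iter k phi)].
have fc : is_contraction f.
  exists (NngNum half0); split => /=; first by rewrite invf_lt1// ltr1n.
  move=> [v w] _ /=.
  rewrite -(ler_pXn2r (n := 2)) ?nnegrE ?mulr_ge0//.
  apply: le_trans (sup_norm_sqr_le _) _; rewrite hiter.
  apply: (@le_trans _ _ (c ^+ 2 ^+ k * (m%:R * `|v - w| ^+ 2))).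
    by apply: ler_wpM2l; [exact/exprn_ge0/sqr_ge0|exact: nsq_le_sup_norm].
  rewrite mulrA [leRHS]exprMn; apply: ler_wpM2r; first exact: sqr_ge0.
  by rewrite (le_trans hk)// exprVn -natrX.
have [v _ /= fv] := banach_fixed_point fc closedT (ex_intro _ 0 I).
exists v; have {}fv : iter k phi v = v by exact: esym fv.
have h : nsq (phi v - v) = c ^+ 2 ^+ k * nsq (phi v - v).
  by rewrite -hiter -iterSr iterS fv.
have ck : c ^+ 2 ^+ k < 1 by rewrite expr_lt1 ?expr_lt1 ?exprn_ge0// ltW.
have /eqP : nsq (phi v - v) = 0 by have := nsq_ge0 (phi v - v); nra.
by rewrite nsq_eq0 subr_eq0 => /eqP.
Qed.

(** The centroid b of the orbit is the only point that minimises the sum S of the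
    squared distances to the orbit, and S is invariant under phi. *)
Lemma isometry_finite_orbit (phi : 'rV[R]_m -> 'rV[R]_m) k v :
  (forall v w, nsq (phi v - phi w) = nsq (v - w)) ->
  (0 < k)%N -> iter k phi v = v -> exists b, phi b = b.
Proof.
move=> hphi k0 kv.
pose S x := \sum_(i < k) nsq (x - iter i phi v).
pose b := k%:R^-1 *: \sum_(i < k) iter i phi v.
have kn0 : k%:R != 0 :> R by rewrite pnatr_eq0 -lt0n.
have hb : \sum_(i < k) (b - iter i phi v) = 0.
  rewrite sumrB sumr_const card_ord -scaler_nat /b scalerA divff// scale1r.
  by rewrite subrr.
have S1 x : S x = k%:R * nsq (x - b) + S b.
  have -> : S x = \sum_(i < k) (nsq (x - b) + 2 * dot (b - iter i phi v) (x - b)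
      + nsq (b - iter i phi v)).
    apply: eq_bigr => i _; set u := iter i phi v.
    have -> : x - u = (x - b) + (b - u) by rewrite addrA subrK.
    exact: nsqD.
  rewrite 2!big_split /= sumr_const card_ord -mulr_sumr.
  have -> : \sum_(i < k) dot (b - iter i phi v) (x - b) = 0.
    by rewrite -dot_suml hb dot0l.
  by rewrite mulr0 addr0 mulr_natl.
have S2 x : S (phi x) = S x.
  transitivity (\sum_(i < k) nsq (phi x - iter i.+1 phi v)).
    case: k k0 kv {b kn0 hb S1} @S => // k _ kv S.
    rewrite /S big_ord_recl big_ord_recr [LHS]addrC; congr (_ + _).
    by rewrite kv.
  by apply: eq_bigr => i _; rewrite iterS hphi.
exists b; have /eqP := S1 (phi b); rewrite S2 -subr_eq subrr eq_sym mulf_eq0 (negbTE kn0)/=.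
by rewrite nsq_eq0 subr_eq0 => /eqP.
Qed.

End Similarities.

(** * Isometries fixing and moving infinity *)

Section IdealPoints.
Context {R : realType} {n : nat}.
Local Notation V := ('rV[R]_n.-1).
Local Notation HH := (set_type (@upper_half_space R n)).
Implicit Types (x y z : HH) (v w : V) (xi eta : boundary R n) (f g h : isom R n).

Lemma bdry_invK f xi : bdry f^-1%g (bdry f xi) = xi.
Proof. by rewrite -bdryM mulVg bdry1. Qed.

Lemma bdryVK f xi : bdry f (bdry f^-1%g xi) = xi.
Proof. by rewrite -bdryM mulgV bdry1. Qed.

Lemma bdryX f k xi : bdry (f ^+ k)%g xi = iter k (bdry f) xi.
Proof. by elim: k => [|k IH]; rewrite ?expg0 ?bdry1// expgS bdryM IH. Qed.

Lemma isomX f k x : (f ^+ k)%g x = iter k f x.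
Proof. by elim: k => [//|k IH]; rewrite expgS -[LHS]/(f ((f ^+ k)%g x)) IH. Qed.

(** Preserving the horofunction 1 / t of infinity up to a factor means scaling the
    heights by c, and then the invariance of the pairing makes the base points
    transform by a similarity of ratio c. *)
Lemma fix_infty_similarity g : bdry g infty = infty ->
  exists c phi, [/\ 0 < c,
    forall x, val (g x) = (phi (val x).1, c * (val x).2),
    forall v w, nsq (phi v - phi w) = c ^+ 2 * nsq (v - w) &
    forall v, bdry g (Some v) = Some (phi v)].
Proof.
move=> ginf; have [c c0 /=] := horofun_bdry g infty; rewrite ginf /= => Hc.
have height x : (val (g x)).2 = c * (val x).2.
  have h1 := height_gt0 x; have h2 := height_gt0 (g x).
  have -> : (val (g x)).2 = (val (g x)).2 * (val x).2 * ((val x).2)^-1.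
    by field; rewrite gt_eqF.
  by rewrite Hc; field; rewrite gt_eqF.
have dist x y : nsq ((val (g x)).1 - (val (g y)).1) = c ^+ 2 * nsq ((val x).1 - (val y).1).
  have := isom_pairing g x y; rewrite /pairing !height.
  have h1 := height_gt0 x; have h2 := height_gt0 y.
  move: (nsq _) (nsq _) => B A e.
  have -> : A = (A + (c * (val x).2) ^+ 2 + (c * (val y).2) ^+ 2) /
      (c * (val x).2 * (c * (val y).2)) * (c * (val x).2 * (c * (val y).2))
      - (c * (val x).2) ^+ 2 - (c * (val y).2) ^+ 2.
    by field; rewrite !gt_eqF.
  by rewrite e; field; rewrite !gt_eqF.
pose phi v := (val (g (hpoint v (@ltr01 R)))).1.
have gE x : val (g x) = (phi (val x).1, c * (val x).2).
  rewrite [LHS]surjective_pairing height; congr pair.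
  apply/eqP; rewrite -subr_eq0 -nsq_eq0 dist /= subrr nsq0 mulr0//.
have phiE v w : nsq (phi v - phi w) = c ^+ 2 * nsq (v - w) by rewrite dist.
exists c, phi; split=> // v.
apply: (@bdry_eq _ _ _ _ _ c^-1) => y /=; rewrite /horo gE /= phiE.
by field; rewrite !gt_eqF ?height_gt0.
Qed.

Lemma parabolic_no_finite_fixed g v : parabolic g -> bdry g infty = infty ->
  bdry g (Some v) <> Some v.
Proof.
move=> [_ _ [xi E]] ginf gv.
have : [set zeta | bdry g zeta = zeta] infty by [].
have : [set zeta | bdry g zeta = zeta] (Some v) by [].
by rewrite E /= => <-.
Qed.

(** If c < 1 the similarity phi has a fixed point, and if c > 1 the one of g^-1
    does: either way g would fix a second ideal point. *)
Lemma parabolic_isometry g : parabolic g -> bdry g infty = infty ->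
  exists phi, [/\ forall x, val (g x) = (phi (val x).1, (val x).2),
    forall v w, nsq (phi v - phi w) = nsq (v - w),
    forall v, bdry g (Some v) = Some (phi v) &
    forall k v, (0 < k)%N -> iter k phi v <> v].
Proof.
move=> gp ginf.
have nofix v := parabolic_no_finite_fixed (v := v) gp ginf.
have [c [phi [c0 gE phiE bE]]] := fix_infty_similarity ginf.
have c1 : c = 1.
  have [c1|c1|//] := ltrgtP c 1.
    have [|v] := similarity_fixed_point _ phiE; first by rewrite c0.
    by move=> hv; case: (nofix v); rewrite bE hv.
  have ginf' : bdry g^-1%g infty = infty by rewrite -[in LHS]ginf bdry_invK.
  have [d [psi [d0 gE' psiE bE']]] := fix_infty_similarity ginf'.
  have x := hpoint (0 : V) (@ltr01 R).
  have cd : d * c = 1.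
    have gx : g^-1%g (g x) = x by exact: isomK.
    have := congr1 snd (gE' (g x)); rewrite gx gE /= => e.
    have x0 := height_gt0 x; apply: (mulIf (negbT (gt_eqF x0))).
    by rewrite mul1r -mulrA -e.
  have [|v] := similarity_fixed_point _ psiE; first by rewrite d0/=; nra.
  move=> hv; case: (nofix v); have e := bE' v; rewrite hv in e.
  by rewrite -{1}e bdryVK.
exists phi; split => //.
- by move=> x; rewrite gE c1 mul1r.
- by move=> v w; rewrite phiE c1 expr1n mul1r.
- move=> k v k0 kv.
  have [|b hb] := isometry_finite_orbit _ k0 kv.
    by move=> u w; rewrite phiE c1 expr1n mul1r.
  by case: (nofix b); rewrite bE hb.
Qed.

Section OffInfinity.
Variable h : isom R n.
Hypothesis hinf : bdry h infty <> infty.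
Local Notation a := (isom_center h).
Local Notation b := (isom_center h^-1%g).

Lemma bdry_center_inv : bdry h infty = Some b.
Proof. by rewrite /isom_center invgK; case: (bdry h infty) hinf. Qed.

Lemma bdry_center : bdry h (Some a) = infty.
Proof.
have : bdry h^-1%g infty <> infty.
  by move=> e; apply: hinf; rewrite -[X in bdry h X]e bdryVK.
rewrite /isom_center; case E : (bdry h^-1%g infty) => [v|] // _ /=.
by rewrite -E bdryVK.
Qed.

(** The relation between the horofunctions of a and infinity gives the height
    c / s of h(a, s); the invariance of the pairing then makes the base point of
    h(a, s) independent of s; and it is b by the relation between the
    horofunctions of infinity and b at two heights. *)
Lemma axis_image : exists2 c, 0 < c & forall x, (val x).1 = a ->
  val (h x) = (b, c / (val x).2).
Proof.
have [c c0 Hc] := horofun_bdry h (Some a); rewrite bdry_center in Hc.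
have [d d0 Hd] := horofun_bdry h infty; rewrite bdry_center_inv in Hd.
have height x : (val x).1 = a -> (val (h x)).2 = c / (val x).2.
  move=> xa; have := Hc x; rewrite /= /horo xa subrr nsq0 add0r => e.
  have h1 := height_gt0 x; have h2 := height_gt0 (h x).
  have -> : (val (h x)).2 = (val (h x)).2 * ((val x).2 ^+ 2 / (val x).2) / (val x).2.
    by field; rewrite gt_eqF.
  by rewrite e; field; rewrite !gt_eqF.
have dist x y : (val x).1 = a -> (val y).1 = a -> nsq ((val (h x)).1 - (val (h y)).1) = 0.
  move=> xa ya; have := isom_pairing h x y; rewrite /pairing !height// xa ya subrr nsq0.
  have h1 := height_gt0 x; have h2 := height_gt0 y.
  move: (nsq _) => N e.
  have -> : N = (N + (c / (val x).2) ^+ 2 + (c / (val y).2) ^+ 2) /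
     (c / (val x).2 * (c / (val y).2)) * (c / (val x).2 * (c / (val y).2))
     - (c / (val x).2) ^+ 2 - (c / (val y).2) ^+ 2.
    by field; rewrite !gt_eqF.
  by rewrite e; field; rewrite !gt_eqF.
exists c => // x xa.
rewrite [LHS]surjective_pairing height//; congr pair.
apply/eqP; rewrite -subr_eq0 -nsq_eq0 nsqBC.
have lt02 : 0 < 2 :> R by [].
pose x1 := hpoint a (@ltr01 R); pose x2 := hpoint a lt02.
have e z : (val z).1 = a -> nsq ((val (h x)).1 - b) = nsq ((val (h z)).1 - b).
  move=> za; have /eqP := dist x z xa za.
  by rewrite nsq_eq0 subr_eq0 => /eqP ->.
have := Hd x1; have := Hd x2.
rewrite /= /horo -!e// !height//= nsqBC.
move: (nsq _) => N e2 e1.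
have {}e1 : c = d * (N + c ^+ 2).
  by rewrite -[LHS]mul1r -[1 in LHS]invr1 e1; field; rewrite gt_eqF.
have {}e2 : c = d * (4 * N + c ^+ 2).
  transitivity (2 * c * 2^-1); first by field.
  by rewrite e2; field; rewrite gt_eqF.
have /eqP : d * N = 0 by lra.
by rewrite mulf_eq0 (gt_eqF d0).
Qed.

(** A point of the sphere of radius r about a is sent to one of the sphere of
    radius r about b. The relation between their horofunctions, restricted to the
    vertical line over a, forces c = r^2. *)
Lemma axis_image_radius r : (0 < n.-1)%N -> 0 < r ->
  bdry h @` esphere a r = esphere b r ->
  forall x, (val x).1 = a -> val (h x) = (b, r ^+ 2 / (val x).2).
Proof.
move=> n0 r0 hS; have [c c0 Hc] := axis_image.
suff <- : c = r ^+ 2 by [].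
have : esphere b r (bdry h (Some (a + r *: delta_mx 0 (Ordinal n0)))).
  rewrite -hS; eexists; last reflexivity.
  eexists; last reflexivity.
  by rewrite /= addrC addKr enormE nsqZ nsq_delta mulr1 sqrtr_sqr gtr0_norm.
move=> [w /= wr bE].
have {}wr : nsq (w - b) = r ^+ 2 by rewrite -wr enorm_sqr.
have [k k0] := horofun_bdry h (Some (a + r *: delta_mx 0 (Ordinal n0))).
rewrite -bE /= => Hk.
have lt02 : 0 < 2 :> R by [].
have := Hk (hpoint a (@ltr01 R)); have := Hk (hpoint a lt02).
rewrite /horo !Hc//= opprD addrA subrr add0r nsqN nsqZ nsq_delta nsqBC wr.
move=> e2 e1.
have {}e1 : (r ^+ 2 + 1) * c = k * (r ^+ 2 + c ^+ 2).
  have -> : (r ^+ 2 + 1) * c = (r ^+ 2 * 1 + 1 ^+ 2) / 1 * c by field.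
  by rewrite e1; field; rewrite gt_eqF.
have {}e2 : (r ^+ 2 + 4) * c = k * (4 * r ^+ 2 + c ^+ 2).
  have -> : (r ^+ 2 + 4) * c = (r ^+ 2 * 1 + 2 ^+ 2) / 2 * (2 * c) by field.
  by rewrite e2; field; rewrite gt_eqF.
have ck : c = k * r ^+ 2 by lra.
have : k * (c ^+ 2 - (r ^+ 2) ^+ 2) = 0.
  by rewrite ck in e1 *; lra.
move/eqP; rewrite mulf_eq0 (gt_eqF k0)/= subr_eq0 eqrXn2 ?ltW ?exprn_gt0//.
by move/eqP.
Qed.

End OffInfinity.

End IdealPoints.

(** * Displacement of a parabolic element *)

Section Displacement.
Context {R : realType} {n : nat}.
Local Notation V := ('rV[R]_n.-1).
Local Notation HH := (set_type (@upper_half_space R n)).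
Implicit Types (x y z : HH) (v w : V) (xi eta : boundary R n) (f g h : isom R n).

(** The monotonicity of cosh on the non-negative reals. *)
Lemma expRD_expRN_lt (a b : R) : 0 <= b ->
  expR a + expR (- a) < expR b + expR (- b) -> a < b.
Proof.
move=> b0; apply: contraPT; rewrite -leNgt => ba; apply/negP; rewrite -leNgt.
have A := expR_gt0 a; have B := expR_gt0 b.
have B1 : 1 <= expR b by rewrite -expR0 ler_expR.
have AB : expR b <= expR a by rewrite ler_expR.
rewrite !expRN -subr_ge0.
have -> : expR a + (expR a)^-1 - (expR b + (expR b)^-1) =
  (expR a - expR b) * (expR a * expR b - 1) / (expR a * expR b).
  by field; rewrite !gt_eqF.
have AB1 : 1 <= expR a * expR b by nra.
by rewrite divr_ge0 ?(mulr_ge0, subr_ge0, ltW A, ltW B).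
Qed.

Lemma two_cosh_sub2_gt0 (eps : R) : 0 < eps -> 0 < 2 * cosh eps - 2.
Proof.
move=> e0; have E := expR_gt0 eps; have E1 : 1 < expR eps by rewrite -expR0 ltr_expR.
rewrite /cosh expRN.
have -> : 2 * ((expR eps + (expR eps)^-1) / 2) - 2 = (expR eps - 1) ^+ 2 / expR eps.
  by field; rewrite gt_eqF.
by rewrite divr_gt0// exprn_gt0// subr_gt0.
Qed.

Lemma rho_lt_same_height (eps : R) x y : 0 < eps -> (val x).2 = (val y).2 ->
  enorm ((val x).1 - (val y).1) / Num.sqrt (2 * cosh eps - 2) < (val y).2 ->
  rho x y < eps.
Proof.
move=> e0 xy; have K0 := two_cosh_sub2_gt0 e0; have y0 := height_gt0 y.
rewrite ltr_pdivrMr ?sqrtr_gt0// => h.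
apply: expRD_expRN_lt; first exact: ltW.
rewrite -pairing_rho /pairing xy.
have : nsq ((val x).1 - (val y).1) < (val y).2 ^+ 2 * (2 * cosh eps - 2).
  rewrite -enorm_sqr -[X in _ < _ * X]sqr_sqrtr ?ltW// -exprMn.
  by rewrite ltr_pXn2r ?nnegrE ?mulr_ge0 ?enorm_ge0 ?sqrtr_ge0 ?(ltW y0).
rewrite /cosh => h2; rewrite ltr_pdivrMr ?mulr_gt0//; lra.
Qed.

Section BoundaryFunction.
Variables (eps : R) (g : isom R n) (phi : V -> V).
Hypotheses (eps0 : 0 < eps) (bE : forall v, bdry g (Some v) = Some (phi v)).

Lemma iter_bdry k v : iter k (bdry g) (Some v) = Some (iter k phi v).
Proof. by elim: k => //= k ->. Qed.

Let K := Num.sqrt (2 * cosh eps - 2).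

Lemma boundary_functionE v : boundary_function eps g v =
  inf [set enorm (iter i phi v - v) / K | i in [set i | (0 < i)%N]].
Proof.
congr inf; apply/seteqP; split=> r /=.
  by move=> [i [w [i0]]]; rewrite iter_bdry => -[<-] ->; exists i.
by move=> [i i0 <-]; exists i, (iter i phi v); rewrite iter_bdry.
Qed.

Let dist_ge0 i v : 0 <= enorm (iter i phi v - v) / K.
Proof. by rewrite divr_ge0 ?sqrtr_ge0 ?enorm_ge0. Qed.

Lemma boundary_function_ge0 v : 0 <= boundary_function eps g v.
Proof.
rewrite boundary_functionE; apply: lb_le_inf; first by eexists; exists 1%N.
by move=> _ [i _ <-].
Qed.

Lemma boundary_function_lt v u : boundary_function eps g v < u ->
  exists2 i, (0 < i)%N & enorm (iter i phi v - v) / K < u.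
Proof.
rewrite boundary_functionE => /inf_lt[|_ [i i0 <-] lt_u]; last by exists i.
by eexists; exists 1%N.
Qed.

End BoundaryFunction.

(** Some positive powers of p and q lie in the nilpotent subgroup of finite
    index, and have the same fixed points as p and q. *)
Lemma virtually_nilpotent_common_fixed_point (A : set (isom R n)) p q xi eta :
  is_subgroup A -> virtually_nilpotent A -> A p -> A q ->
  (forall k, (0 < k)%N -> forall t, bdry (p ^+ k)%g t = t <-> t = xi) ->
  (forall k, (0 < k)%N -> forall t, bdry (q ^+ k)%g t = t <-> t = eta) ->
  xi = eta.
Proof.
move=> sA [N [sN NA fin nil]] Ap Aq fixp fixq.
have [k k0 Nk] := finite_index_power sN sA fin Ap.
have [l l0 Nl] := finite_index_power sN sA fin Aq.
exact: (nilpotent_common_fixed_point bdryM bdry1 sN nil Nk Nl (fixp k k0) (fixq l l0)).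
Qed.

End Displacement.

(** * The estimate for the isometric sphere *)

Lemma product_gap (R : realType) (B1 B2 r : R) : 0 <= B1 -> 0 <= B2 ->
  B1 * B2 < r -> exists u1 u2, [/\ B1 < u1, B2 < u2 & u1 * u2 < r].
Proof.
move=> B10 B20 hr.
have s0 : 0 < B1 + B2 + 2 by lra.
pose d := Num.min 1 ((r - B1 * B2) / (B1 + B2 + 2)).
have d0 : 0 < d by rewrite lt_min ltr01 divr_gt0// subr_gt0.
have d1 : d <= 1 by rewrite ge_min lexx.
have d2 : d * (B1 + B2 + 2) <= r - B1 * B2.
  by rewrite -ler_pdivlMr// ge_min lexx orbT.
exists (B1 + d), (B2 + d); split; [lra|lra|].
nra.
Qed.

Theorem theorem1 (R : realType) (n : nat) (eps : R) (g h : isom R n) :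
  (2 <= n)%N ->
  0 < eps -> (eps%:E < margulis_constant R n)%E ->
  Isom_plus g -> Isom_plus h ->
  parabolic g -> bdry g infty = infty ->
  bdry h infty <> infty ->
  discrete (generated [set g; h]) ->
  isom_radius h <=
    Num.sqrt (boundary_function eps g (isom_center h) *
              boundary_function eps g (isom_center h^-1%g)).
Proof.
move=> n2 eps0 /ereal_sup_gt[_ [mu [mu0 Hmu] <-]]; rewrite lte_fin => eps_mu.
move=> gP hP gpar ginf hinf disc.
set a := isom_center h; set b := isom_center h^-1%g.
have [phi [gE phiE bE nofix]] := parabolic_isometry gpar ginf.
have B0 := boundary_function_ge0 eps bE.
rewrite /isom_radius; case: xgetP => [r _ [r0 hS]|_]; last exact: sqrtr_ge0.
rewrite leNgt; apply/negP => hlt.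
have {}hlt : boundary_function eps g a * boundary_function eps g b < r ^+ 2.
  by rewrite -[X in X < _]sqr_sqrtr ?mulr_ge0// ltr_pXn2r ?nnegrE ?sqrtr_ge0 ?ltW.
(* u1 is the height of the point x over a, and u2 bounds the height of h x
   from below. *)
have [u1 [u2 [Bu1 Bu2 u12]]] := product_gap (B0 a) (B0 b) hlt.
have [i i0 hi] := boundary_function_lt bE Bu1.
have [j j0 hj] := boundary_function_lt bE Bu2.
have u10 : 0 < u1 by apply: le_lt_trans Bu1.
have gX k x : val ((g ^+ k)%g x) = (iter k phi (val x).1, (val x).2).
  by rewrite isomX; elim: k => [|k IH] /=; [case: (val x)|rewrite gE IH].
pose x := hpoint a u10.
(* q = h^-1 g^j h moves x exactly as far as g^j moves h x. *)
pose p := (g ^+ i)%g; pose q := ((g ^+ j) ^ h)%g.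
have px : rho (p x) x < mu.
  by apply: lt_trans eps_mu; apply: rho_lt_same_height => //; rewrite gX.
have qx : rho (q x) x < mu.
  apply: lt_trans eps_mu; rewrite -(isom_rho h).
  have -> : h (q x) = (g ^+ j)%g (h x) by exact: isomVK.
  have hx := axis_image_radius hinf _ r0 hS.
  apply: rho_lt_same_height => //; rewrite gX hx//=; try by rewrite -subn1 subn_gt0.
  by apply: lt_trans hj _; rewrite ltr_pdivlMr// mulrC.
pose Gamma : set (isom R n) := generated [set g; h].
have sG : is_subgroup Gamma by exact: generated_subgroup.
have [_ GM GV] := sG.
have Gg : Gamma g by apply: sub_generated; left.
have Gh : Gamma h by apply: sub_generated; right.
have GP : Gamma `<=` @Isom_plus R n.
  by apply: generated_sub; [exact: Isom_plus_subgroup|move=> _ [->|->]].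
have := Hmu Gamma sG GP disc x.
set A := generated _ => vnA.
have Ap : A p by apply: sub_generated; split => //; exact: (subgroupX _ sG).
have Aq : A q.
  apply: sub_generated; split=> //.
  by apply: (GM); [exact: GV|apply: GM => //; exact: (subgroupX _ sG)].
have fixg k t : (0 < k)%N -> bdry (g ^+ k)%g t = t <-> t = infty.
  move=> k0; rewrite bdryX; split => [|->]; last by elim: k {k0} => //= k ->.
  case: t => [v|]//; rewrite (iter_bdry bE) => -[] /nofix; exact.
have fixp k : (0 < k)%N -> forall t, bdry (p ^+ k)%g t = t <-> t = infty.
  by move=> k0 t; rewrite -expgnA; apply: fixg; rewrite muln_gt0 i0.
have fixq k : (0 < k)%N -> forall t, bdry (q ^+ k)%g t = t <-> t = Some a.
  move=> k0 t; rewrite -conjXg -expgnA conjgE !bdryM.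
  have jk0 : (0 < j * k)%N by rewrite muln_gt0 j0.
  split => [e|->].
    have : bdry h t = infty.
      by apply/(fixg _ _ jk0); rewrite -[in RHS]e bdryVK.
    by move=> ht; rewrite -(bdry_invK h t) ht -(bdry_center hinf) bdry_invK.
  rewrite (bdry_center hinf) (fixg _ _ jk0).2// -(bdry_center hinf).
  exact: bdry_invK.
by have := virtually_nilpotent_common_fixed_point (generated_subgroup _) vnA Ap Aq fixp fixq.
Qed.
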